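(* Suppose $f$ is concave on $\Omega^\circ$. Consider the exact first-order interior-point trust-region algorithm described in the context with trust-region radius $\beta\in(0,1)$. Then for any $\varepsilon\in(0,1]$, the algorithm either returns a $2\varepsilon$-KKT point within $\mathcal{O}(1/\varepsilon)$ iterations, or returns an iterate $\boldsymbol{x}_t$ with $f(\boldsymbol{x}_t)-f(\boldsymbol{x}^* )\le\varepsilon$. The overall time complexity is upper bounded by $\mathcal{O}(nm^{\omega-1}/\varepsilon)$.
   Context: Problem: minimize $f(\boldsymbol{x})$ s.t. $\boldsymbol{A}\boldsymbol{x}=\boldsymbol{b}$, $\boldsymbol{x}\ge\boldsymbol{0}$, with $\boldsymbol{A}\in\mathbb{R}^{m\times n}$, $m\le n$, full row rank, $f$ continuous on $\mathbb{R}^n_+$, differentiable on $\mathbb{R}^n_{++}$. $\Omega^\circ=\{\boldsymbol{x}:\boldsymbol{A}\boldsymbol{x}=\boldsymbol{b},\boldsymbol{x}>\boldsymbol{0}\}$; $\boldsymbol{x}^*$ a global minimizer over the feasible set. $\boldsymbol{X}=\mathrm{diag}(\boldsymbol{x})$, $\boldsymbol{e}$ the all-ones vector, $\phi(\boldsymbol{x})=f(\boldsymbol{x})-\varepsilon\sum_i\ln x_i$. $f$ concave on $\Omega^\circ$ means $f(\boldsymbol{y})\le f(\boldsymbol{x})+\nabla f(\boldsymbol{x})^\top(\boldsymbol{y}-\boldsymbol{x})$ for all $\boldsymbol{x},\boldsymbol{y}\in\Omega^\circ$. A point $\boldsymbol{x}$ is an $\varepsilon'$-KKT point if $\boldsymbol{A}\boldsymbol{x}=\boldsymbol{b}$,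 $\boldsymbol{x}>\boldsymbol{0}$, and there exist $\boldsymbol{\lambda}\in\mathbb{R}^m$, $\boldsymbol{s}\in\mathbb{R}^n_+$ with $\Vert\nabla f(\boldsymbol{x})+\boldsymbol{A}^\top\boldsymbol{\lambda}-\boldsymbol{s}\Vert_\infty\le\varepsilon'$ and $|x_is_i|\le\varepsilon'$ for all $i$. Initialization: $\boldsymbol{x}_0\in\Omega^\circ$ with $-\sum_i\ln x_i\ge-\sum_i\ln x_{0,i}-C_0$ for all $\boldsymbol{x}\in\Omega^\circ$. Exact first-order IPTR algorithm: at iteration $t$, let $\boldsymbol{d}_t$ be an optimal solution of $\min\ \nabla\phi(\boldsymbol{x}_t)^\top\boldsymbol{X}_t\boldsymbol{d}$ s.t. $\boldsymbol{A}\boldsymbol{X}_t\boldsymbol{d}=\boldsymbol{0}$, $\Vert\boldsymbol{d}\Vert\le\beta$ (when $\boldsymbol{P}_t\boldsymbol{X}_t\nabla\phi(\boldsymbol{x}_t)\ne\boldsymbol{0}$ it is $-\beta\boldsymbol{P}_t\boldsymbol{X}_t\nabla\phi(\boldsymbol{x}_t)/\Vert\boldsymbol{P}_t\boldsymbol{X}_t\nabla\phi(\boldsymbol{x}_t)\Vert$ with $\boldsymbol{P}_t=\boldsymbol{I}-\boldsymbol{X}_t\boldsymbol{A}^\top(\boldsymbol{A}\boldsymbol{X}_t^2\boldsymbol{A}^\top)^{-1}\boldsymbol{A}\boldsymbol{X}_t$); set $\boldsymbol{x}_{t+1}=\boldsymbol{x}_t+\boldsymbol{X}_t\boldsymbol{d}_t$;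 if $\phi(\boldsymbol{x}_{t+1})-\phi(\boldsymbol{x}_t)>-\varepsilon\beta(1-\beta)$, return $\boldsymbol{x}_t$. The algorithm runs for at most $T=(f(\boldsymbol{x}_0)-f(\boldsymbol{x}^* )+(C_0-1)\varepsilon)/(\varepsilon\beta(1-\beta))$ iterations. $\omega$ is the matrix-multiplication exponent.
   Formalization: The ''2ε-KKT point or gap at most ε'' alternative is proved only for radii with −β−β² ≤ ln(1−β) (β up to about 0.68), since it fails for larger β even with linear f; the iteration and time bounds are proved for all β in (0,1). *)

(* Defs.v *)
From HB Require Import structures.
From mathcomp Require Import all_boot all_order all_algebra.
From mathcomp Require Import all_classical all_reals all_analysis.

Set Implicit Arguments.
Unset Strict Implicit.
Unset Printing Implicit Defensive.
Import Order.TTheory GRing.Theory Num.Theory.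
Import numFieldNormedType.Exports.

Local Open Scope classical_set_scope.
Local Open Scope ring_scope.

(** * Linearly constrained problem: minimize f x  s.t.  A x = b, x >= 0 *)

Section Problem.
Variables (R : realType) (m n : nat).
Implicit Types (A : 'M[R]_(m, n)) (b : 'cV[R]_m).
Implicit Types (f : 'cV[R]_n -> R) (x y d : 'cV[R]_n).

Definition nonneg : set 'cV[R]_n := [set x | forall i, 0 <= x i 0].
Definition positive : set 'cV[R]_n := [set x | forall i, 0 < x i 0].

Definition feasible A b : set 'cV[R]_n := [set x | A *m x = b] `&` nonneg.
Definition interior_feasible A b : set 'cV[R]_n :=
  [set x | A *m x = b] `&` positive.

Definition dot x y : R := \sum_i x i 0 * y i 0.

Definition norm2 x : R := Num.sqrt (dot x x).

Definition grad f x : 'cV[R]_n := \col_i 'D_(delta_mx i 0) f x.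

Definition diag x : 'M[R]_n := diag_mx x^T.

Definition is_global_min A b f x :=
  feasible A b x /\ forall y, feasible A b y -> f x <= f y.

Definition concave_on (D : set 'cV[R]_n) f :=
  forall x y, D x -> D y -> f y <= f x + dot (grad f x) (y - x).

(* The norm `| . | of a matrix type is the largest absolute value of an entry,
   hence the infinity norm here. *)
Definition kkt_point A b f (eps : R) x :=
  interior_feasible A b x /\
  exists (lambda : 'cV[R]_m) (s : 'cV[R]_n),
    [/\ nonneg s, `|grad f x + A^T *m lambda - s| <= eps
      & forall i, `|x i 0 * s i 0| <= eps].

Definition barrier x : R := - \sum_i ln (x i 0).

Definition phi f (eps : R) x : R := f x - eps * \sum_i ln (x i 0).

End Problem.

(** * The exact first-order interior-point trust-region algorithm *)

Section Algorithm.
Variables (R : realType) (m n : nat).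
Variables (A : 'M[R]_(m, n)) (f : 'cV[R]_n -> R) (eps beta : R).
Implicit Types (x y d : 'cV[R]_n).

Definition trust_region x : set 'cV[R]_n :=
  [set d | A *m diag x *m d = 0 /\ norm2 d <= beta].

Definition trust_region_solution x d :=
  trust_region x d /\
  forall d', trust_region x d' ->
    dot (grad (phi f eps) x) (diag x *m d)
      <= dot (grad (phi f eps) x) (diag x *m d').

Definition next_iterate x d := x + diag x *m d.

(* The threshold eps * beta * (1 - beta) comes from the logarithmic bound
   - ln (1 + u) <= - u + u ^+ 2, which is valid for all u in [-beta, beta] if
   and only if - beta - beta ^+ 2 <= ln (1 - beta), that is for beta up to
   0.6838...  For a larger radius the test may succeed at a point that is
   neither an approximate KKT point nor nearly optimal, even if f is linear. *)
Definition stopping_test x d :=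
  - (eps * beta * (1 - beta)) < phi f eps (next_iterate x d) - phi f eps x.

Definition iteration_limit (x0 xstar : 'cV[R]_n) (C0 : R) : R :=
  (f x0 - f xstar + (C0 - 1) * eps) / (eps * beta * (1 - beta)).

(* [returns T t x N y]: with the current iterate x and t iterations already
   performed, the algorithm with iteration limit T may return y after N
   iterations in total.  This is a relation since the trust-region subproblem
   may have several solutions.  T need not be an integer: a new iteration is
   started as long as t < T, and once t >= T the current iterate is returned. *)
Inductive returns (T : R) : nat -> 'cV[R]_n -> nat -> 'cV[R]_n -> Prop :=
| ReturnsLimit t x :
    T <= t%:R -> returns T t x t x
| ReturnsStop t x d :
    t%:R < T -> trust_region_solution x d -> stopping_test x d ->
    returns T t x t.+1 x
| ReturnsStep t x d N y :
    t%:R < T -> trust_region_solution x d -> ~ stopping_test x d ->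
    returns T t.+1 (next_iterate x d) N y -> returns T t x N y.

End Algorithm.

(** * Real register machine with unit-cost operations *)

Section Machine.
Variable R : realType.

Definition memory := nat -> R.

Definition store (s : memory) (dst : nat) (v : R) : memory :=
  fun i => if i == dst then v else s i.

(* The entries of the matrix M are stored row by row from address p on. *)
Definition mx_at m n (s : memory) (p : nat) (M : 'M[R]_(m, n)) :=
  forall (i : 'I_m) (j : 'I_n), s (p + i * n + j)%N = M i j.

Definition read_vec n (s : memory) (p : nat) : 'cV[R]_n :=
  \col_(i < n) s (p + i)%N.

Definition write_vec n (s : memory) (p : nat) (v : 'cV[R]_n) : memory :=
  fun a => if [pick i : 'I_n | a == (p + i)%N] is Some i then v i 0 else s a.

(* The first argument of an instruction is its destination.  Division is that
   of the field R, where x / 0 = 0. *)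
Inductive instr :=
| Const of nat & R
| Add of nat & nat & nat
| Sub of nat & nat & nat
| Mul of nat & nat & nat
| Div of nat & nat & nat.

Definition step (s : memory) (c : instr) : memory :=
  match c with
  | Const r c => store s r c
  | Add r i j => store s r (s i + s j)
  | Sub r i j => store s r (s i - s j)
  | Mul r i j => store s r (s i * s j)
  | Div r i j => store s r (s i / s j)
  end.

(* omega is an admissible exponent of matrix multiplication over R: p x p
   matrices can be multiplied with O(p ^ omega) arithmetic operations, by a
   straight-line program for each p, whatever the initial contents of the
   memory cells that do not hold the two factors. *)
Definition mm_exponent (omega : R) :=
  exists C : R, forall p : nat, (0 < p)%N ->
  exists2 prog : seq instr,
    (size prog)%:R <= C * p%:R `^ omega &
    forall (s : memory) (M N : 'M[R]_p),
      mx_at s 0 M -> mx_at s (p * p) N ->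
      mx_at (foldl step s prog) (2 * (p * p)) (M *m N).

(* Test and loop conditions compare two memory cells.  [Value dst src] and
   [Gradient dst src] are oracle calls at the point stored from src on. *)
Inductive program :=
| Skip
| Instr of instr
| Sqrt of nat & nat
| Ln of nat & nat
| Value of nat & nat
| Gradient of nat & nat
| Seq of program & program
| IfLe of nat & nat & program & program
| WhileLt of nat & nat & program.

(* [exec f P s s' k]: with oracles for f and its gradient, P started in s halts
   in s' at cost k.  An oracle call is charged n, the dimension of its
   argument; any other operation or comparison is charged 1. *)
Inductive exec n (f : 'cV[R]_n -> R) :
  program -> memory -> memory -> nat -> Prop :=
| ExecSkip s : exec f Skip s s 0
| ExecInstr c s : exec f (Instr c) s (step s c) 1
| ExecSqrt r i s : exec f (Sqrt r i) s (store s r (Num.sqrt (s i))) 1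
| ExecLn r i s : exec f (Ln r i) s (store s r (ln (s i))) 1
| ExecValue r p s : exec f (Value r p) s (store s r (f (read_vec n s p))) n
| ExecGradient r p s :
    exec f (Gradient r p) s (write_vec s r (grad f (read_vec n s p))) n
| ExecSeq P Q s s' s'' k l :
    exec f P s s' k -> exec f Q s' s'' l -> exec f (Seq P Q) s s'' (k + l)
| ExecIfTrue i j P Q s s' k :
    s i <= s j -> exec f P s s' k -> exec f (IfLe i j P Q) s s' k.+1
| ExecIfFalse i j P Q s s' k :
    s j < s i -> exec f Q s s' k -> exec f (IfLe i j P Q) s s' k.+1
| ExecWhileEnd i j P s :
    s j <= s i -> exec f (WhileLt i j P) s s 1
| ExecWhileLoop i j P s s' s'' k l :
    s i < s j -> exec f P s s' k -> exec f (WhileLt i j P) s' s'' l ->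
    exec f (WhileLt i j P) s s'' (k + l).+1.

(* Input layout: A, b, x0, eps, beta and the iteration limit T. *)
Definition input_at m n (s : memory) (A : 'M[R]_(m, n)) (b : 'cV[R]_m)
    (x0 : 'cV[R]_n) (eps beta T : R) :=
  let p := (m * n + m + n)%N in
  [/\ mx_at s 0 A, mx_at s (m * n) b, mx_at s (m * n + m) x0
    & [/\ s p = eps, s p.+1 = beta & s p.+2 = T]].

End Machine.

(* Main.v *)
Require Import Defs.
From HB Require Import structures.
From mathcomp Require Import all_boot all_order all_algebra.
From mathcomp Require Import all_classical all_reals all_analysis.
From mathcomp Require Import ring lra zify.
Import Order.TTheory GRing.Theory Num.Theory.
Import numFieldNormedType.Exports.
Local Open Scope classical_set_scope.
Local Open Scope ring_scope.

Set Implicit Arguments.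
Unset Strict Implicit.
Unset Printing Implicit Defensive.

(** On the scaled direction d = X^-1 (x' - x), the inequality
    ln (1 + u) >= u - u^2 on [-beta, beta] and concavity of f give
    phi x' - phi x <= (X grad phi)^T d + eps beta^2, and the optimal value of the
    linear part is - beta |r|, where r is the projection of X grad phi onto the
    kernel of A X.  If the stopping test succeeds then |r| < eps, and the
    multipliers of the projection are KKT multipliers; otherwise phi decreases by
    eps beta (1 - beta) in every iteration, and the choice of T and of the
    starting point bounds f x_T - f x* by eps.

    For the running time, A X is padded with zero rows to p = 2^k rows, where
    m <= p <= 2 m, and its Gram matrix is completed by the identity.  The Gram
    matrix is a sum of O(n / p) products of p x p matrices, and it is inverted by
    recursion on Schur complements, which stay positive definite.  The products
    are computed by the given straight-line program, relocated above all live
    cells.  All other operations cost O(n m), which is absorbed by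
    n m^(omega - 1) since a program that writes p^2 cells has at least p^2
    instructions. *)

(** * Decrease of the barrier function *)

Section Optimization.
Variables (R : realType) (n : nat).
Implicit Types (f : 'cV[R]_n -> R) (x y d r : 'cV[R]_n).

Lemma mul_diagE x d i : (diag x *m d) i 0 = x i 0 * d i 0.
Proof. by rewrite /diag mul_diag_mx !mxE. Qed.

Lemma dotE x y : dot x y = (x^T *m y) 0 0.
Proof. by rewrite mxE; apply: eq_bigr => i _; rewrite mxE. Qed.

Lemma dotC x y : dot x y = dot y x.
Proof. by apply: eq_bigr => i _; rewrite mulrC. Qed.

Lemma dotxx_ge0 x : 0 <= dot x x.
Proof. by apply: sumr_ge0 => i _; rewrite -expr2 sqr_ge0. Qed.

Lemma norm2_ge0 x : 0 <= norm2 x.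
Proof. exact: sqrtr_ge0. Qed.

Lemma sqr_norm2 x : norm2 x ^+ 2 = dot x x.
Proof. by rewrite sqr_sqrtr // dotxx_ge0. Qed.

Lemma abs_coord_le_norm2 x i : `|x i 0| <= norm2 x.
Proof.
rewrite -(ler_pXn2r (n := 2)) ?nnegrE ?norm2_ge0 //.
rewrite sqr_norm2 real_normK ?num_real // /dot (bigD1 i) //= -expr2 lerDl.
by apply: sumr_ge0 => j _; rewrite -expr2 sqr_ge0.
Qed.

Lemma dotD x y d : dot x (y + d) = dot x y + dot x d.
Proof. by rewrite !dotE mulmxDr mxE. Qed.

Lemma dotZ x (c : R) d : dot x (c *: d) = c * dot x d.
Proof. by rewrite !dotE -scalemxAr mxE. Qed.

Lemma norm2Z (c : R) x : norm2 (c *: x) = `|c| * norm2 x.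
Proof.
rewrite /norm2 dotZ -sqrtr_sqr -sqrtrM ?sqr_ge0 //; congr (Num.sqrt _).
rewrite expr2 -mulrA; congr (_ * _); rewrite /dot mulr_sumr.
by apply: eq_bigr => i _; rewrite mxE mulrA.
Qed.

(** Cauchy-Schwarz on the ball of radius [beta], read off from the nonnegativity of the squared norm
    of [rho *: d + beta *: r] with [rho = norm2 r]. The cases [rho = 0] and [beta = 0] are separate
    because the argument cancels both factors. *)
Lemma dot_ge_norm2 r d (beta : R) :
  norm2 d <= beta -> - (beta * norm2 r) <= dot r d.
Proof.
move=> hd; have b0 : 0 <= beta by apply: le_trans (norm2_ge0 d) hd.
have hdd : dot d d <= beta ^+ 2.
  by rewrite -sqr_norm2 ler_pXn2r ?nnegrE ?norm2_ge0.
set rho := norm2 r; have rho0 : 0 <= rho := norm2_ge0 r.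
have [rho_eq0|rho_neq0] := eqVneq rho 0.
  suff -> : dot r d = 0 by rewrite rho_eq0 mulr0 oppr0.
  apply: big1 => i _; have := abs_coord_le_norm2 r i.
  by rewrite -/rho rho_eq0 normr_le0 => /eqP->; rewrite mul0r.
have rho_gt0 : 0 < rho by rewrite lt_def rho_neq0.
have : 0 <= dot (rho *: d + beta *: r) (rho *: d + beta *: r) by exact: dotxx_ge0.
rewrite dotD !dotZ ![dot (_ + _) _]dotC !(dotD, dotZ) (dotC d r) -(sqr_norm2 r) -/rho.
have -> : rho * (rho * dot d d + beta * dot r d) +
   beta * (rho * dot r d + beta * rho ^+ 2) =
   rho * (rho * dot d d + 2 * beta * dot r d + beta ^+ 2 * rho) by ring.
rewrite pmulr_rge0 // => h.
have [b_eq0|b_neq0] := eqVneq beta 0.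
  suff -> : dot r d = 0 by rewrite b_eq0 mul0r oppr0.
  apply: big1 => i _; have := le_trans (abs_coord_le_norm2 d i) hd.
  by rewrite b_eq0 normr_le0 => /eqP->; rewrite mulr0.
have b_gt0 : 0 < beta by rewrite lt_def b_neq0.
have h2 : rho * dot d d <= rho * beta ^+ 2 by rewrite ler_pM2l.
have : 0 <= 2 * beta * (beta * rho + dot r d).
  apply: le_trans h _; apply: (@le_trans _ _
    (rho * beta ^+ 2 + 2 * beta * dot r d + beta ^+ 2 * rho)); last by lra.
  by rewrite !lerD2r.
by rewrite pmulr_rge0 ?mulr_gt0 // => h3; lra.
Qed.

(** The difference [h v = ln (1 + v) - v + v ^+ 2] has derivative [v (1 + 2 v) / (1 + v)]: it
    increases up to -1/2, decreases up to 0 and increases afterwards. Since [h 0 = 0], it is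
    nonnegative from -1/2 on; to the left of -1/2 it is at least [h (- beta)], which the hypothesis
    on [ln (1 - beta)] makes nonnegative. *)
Lemma ln_quadratic_lb (beta u : R) : 0 < beta < 1 ->
  - beta - beta ^+ 2 <= ln (1 - beta) -> - beta <= u <= beta ->
  u - u ^+ 2 <= ln (1 + u).
Proof.
move=> /andP[b0 b1] hb /andP[u1 u2].
pose h (v : R) := ln (1 + v) - v + v ^+ 2.
suff : 0 <= h u by rewrite /h; lra.
have dh (v : R) : -1 < v -> is_derive v 1 h (v * (1 + 2 * v) / (1 + v)).
  move=> v1; have v2 : 0 < 1 + v by lra.
  have hl : is_derive (1 + v) 1 (@ln R) (1 + v)^-1 by exact: is_derive1_ln.
  have hc : is_derive v 1 (@ln R \o (fun v => 1 + v)) ((1 + v)^-1 * 1).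
    apply: is_derive1_comp; rewrite -[X in is_derive _ _ _ X]add0r.
    exact: is_deriveD.
  have -> : h = (@ln R \o (fun v => 1 + v)) - id + (fun v => v ^+ 2) by [].
  apply: is_derive_eq; rewrite /= /GRing.scale /= ?expr1.
  by field; rewrite gt_eqF.
have mono (a b : R) : -1 < a -> a <= b ->
    (forall v, a < v < b -> 0 <= v * (1 + 2 * v)) -> h a <= h b.
  move=> a1 ab hv.
  have cont : {within `[a, b], continuous h}.
    apply: continuous_in_subspaceT => v; rewrite inE /= in_itv /= => /andP[av _].
    apply/differentiable_continuous/derivable1_diffP.
    by have := dh v (lt_le_trans a1 av); case.
  apply: (@ger0_derive1_le_cc R h a b) => //; rewrite ?in_itv /= ?lexx ?ab //.
  - move=> v; rewrite in_itv /= => /andP[av _].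
    by have := dh v (lt_trans a1 av); case.
  - move=> v; rewrite in_itv /= => avb; have /andP[av _] := avb.
    have v1 := lt_trans a1 av; rewrite derive1E.
    have -> := @derive_val _ _ _ _ _ _ _ (dh v v1).
    by rewrite divr_ge0 ?hv //; lra.
have monoN (a b : R) : -1 < a -> a <= b ->
    (forall v, a < v < b -> v * (1 + 2 * v) <= 0) -> h b <= h a.
  move=> a1 ab hv.
  have cont : {within `[a, b], continuous h}.
    apply: continuous_in_subspaceT => v; rewrite inE /= in_itv /= => /andP[av _].
    apply/differentiable_continuous/derivable1_diffP.
    by have := dh v (lt_le_trans a1 av); case.
  apply: (@ler0_derive1_le_cc R h a b) => //; rewrite ?in_itv /= ?lexx ?ab //.
  - move=> v; rewrite in_itv /= => /andP[av _].
    by have := dh v (lt_trans a1 av); case.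
  - move=> v; rewrite in_itv /= => avb; have /andP[av _] := avb.
    have v1 := lt_trans a1 av; rewrite derive1E.
    have -> := @derive_val _ _ _ _ _ _ _ (dh v v1).
    by rewrite mulr_le0_ge0 ?hv // invr_ge0; lra.
have h0 : h 0 = 0 by rewrite /h addr0 ln1; ring.
have [u0|u0] := leP 0 u.
  rewrite -h0; apply: mono => // v /andP[v0 _].
  by rewrite mulr_ge0 //; lra.
have [u3|u3] := leP (- 2^-1) u.
  rewrite -h0; apply: monoN => [||v /andP[v0 v1]]; try lra.
  by rewrite nmulr_rle0; lra.
apply: (@le_trans _ _ (h (- beta))); first by rewrite /h; lra.
apply: mono => // [|v /andP[v0 v1]]; first lra.
by rewrite nmulr_rge0; lra.
Qed.

(** Along the line [h *: d + x] the function becomes the composition of [ln] with the affine map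
    [g], so the one-variable chain rule applies. *)
Lemma is_derive_ln_coord x d (i : 'I_n) : 0 < x i 0 ->
  is_derive x d (fun z : 'cV[R]_n => ln (z i 0)) (d i 0 / x i 0).
Proof.
move=> x0; pose g (h : R) := d i 0 * h + x i 0.
have gE : (fun h : R => ln ((h *: d + x) i 0)) = @ln R \o g.
  by apply/funext => h; rewrite /= !mxE mulrC.
have dg : is_derive (0 : R) (1 : R) g (d i 0).
  have h1 : is_derive (0 : R) (1 : R) (d i 0 \*: @id R) (d i 0 *: 1).
    exact: is_deriveZ.
  rewrite -[X in is_derive _ _ _ X]addr0 -[X in is_derive _ _ _ (X + _)]mulr1.
  exact: is_deriveD.
have hl : is_derive (g 0) 1 (@ln R) (g 0)^-1.
  by apply: is_derive1_ln; rewrite /g mulr0 add0r.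
have hc : is_derive (0 : R) (1 : R) (@ln R \o g) ((g 0)^-1 * d i 0).
  exact: is_derive1_comp.
rewrite /g mulr0 add0r mulrC in hc.
have D1 : derivable (fun z : 'cV[R]_n => ln (z i 0)) x d.
  by apply/derivable1P; rewrite gE; case: hc.
suff D2 : 'D_d (fun z : 'cV[R]_n => ln (z i 0)) x = d i 0 / x i 0.
  exact: DeriveDef D1 D2.
have <- := @derive_val _ _ _ _ _ _ _ hc; rewrite -gE /derive.
apply: (f_equal (fun G : R -> R => lim (G @ (0 : R)^'))).
apply/funext => h; rewrite /= !mxE.
by rewrite /GRing.scale /= mul0r mulr1 addr0 add0r.
Qed.

Lemma grad_phi f eps x : positive x -> differentiable f x ->
  grad (phi f eps) x = \col_i (grad f x i 0 - eps / x i 0).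
Proof.
move=> x0 df; apply/colP => i; rewrite !mxE.
have df' : derivable f x (delta_mx i 0) by exact: diff_derivable.
have hf : is_derive x (delta_mx i 0) f ('D_(delta_mx i 0) f x).
  exact: DeriveDef df' erefl.
have hl j := is_derive_ln_coord (delta_mx i 0) (x0 j).
have hs := is_derive_sum (h := fun j (z : 'cV[R]_n) => ln (z j 0)) hl.
have hz := is_deriveZ eps hs.
have -> : phi f eps = f - (eps \*: \sum_(j < n) (fun z : 'cV[R]_n => ln (z j 0))).
  by apply/funext => z; rewrite /phi /= !fctE fct_sumE.
have := is_deriveB hf hz => h; rewrite (@derive_val _ _ _ _ _ _ _ h).
congr (_ - _); rewrite (bigD1 i) //= big1 ?addr0 => [|j /negPf ji].
  by rewrite mxE !eqxx mul1r.
by rewrite mxE ji mul0r.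
Qed.

End Optimization.

Lemma mulmx_tr_rV_ge0 (R : realFieldType) (n : nat) (v : 'rV[R]_n) :
  0 <= (v *m v^T) 0 0.
Proof. by rewrite mxE sumr_ge0 // => i _; rewrite !mxE -expr2 sqr_ge0. Qed.

Lemma mulmx_tr_rV_eq0 (R : realFieldType) (n : nat) (v : 'rV[R]_n) :
  (v *m v^T) 0 0 = 0 -> v = 0.
Proof.
rewrite mxE => /psumr_eq0P h; apply/rowP => i; rewrite mxE.
have := h _ i isT; rewrite mxE -expr2 => H; apply/eqP.
by rewrite -sqrf_eq0 H // => j _; rewrite mxE -expr2 sqr_ge0.
Qed.

(** A row vector v in the left kernel satisfies [|v B|^2 = 0], hence [v B = 0], hence v = 0. *)
Lemma gram_unitmx (R : realFieldType) (m n : nat) (B : 'M[R]_(m, n)) :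
  row_free B -> B *m B^T \in unitmx.
Proof.
move=> Bfree; rewrite -row_free_unit -kermx_eq0; apply/eqP/row_matrixP => i.
rewrite row0; set v := row i _.
have hv : v *m (B *m B^T) = 0 by rewrite /v -row_mul mulmx_ker row0.
have hB : v *m B = 0.
  by apply: mulmx_tr_rV_eq0; rewrite trmx_mul mulmxA -(mulmxA v) hv mul0mx mxE.
by apply: (row_free_inj Bfree); rewrite hB mul0mx.
Qed.

(** * The trust-region step and approximate KKT points *)

Section TrustRegion.
Variables (R : realType) (m n : nat).
Variables (A : 'M[R]_(m, n)) (b : 'cV[R]_m) (f : 'cV[R]_n -> R) (eps beta : R).
Hypothesis beta01 : 0 < beta < 1.
Implicit Types (x y d r : 'cV[R]_n).

Let scaled_grad x := diag x *m grad (phi f eps) x.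

Lemma dot_scaled_grad x d :
  dot (grad (phi f eps) x) (diag x *m d) = dot (scaled_grad x) d.
Proof. by apply: eq_bigr => i _; rewrite !mul_diagE mulrCA mulrA. Qed.

(* If the norm of r vanishes then so does the direction, as beta / 0 = 0. *)
Lemma projected_gradient_step x r (lambda : 'cV[R]_m) :
  r = scaled_grad x - (A *m diag x)^T *m lambda -> A *m diag x *m r = 0 ->
  let d := - (beta / norm2 r) *: r in
  trust_region_solution A f eps beta x d /\
  dot (grad (phi f eps) x) (diag x *m d) = - (beta * norm2 r).
Proof.
have /andP[b0 _] := beta01; move=> rE Br0 d.
(* On the kernel of [A *m diag x] the linear objective is the product with r, because the rest of
   the scaled gradient lies in the row space. *)
have dotr d' : A *m diag x *m d' = 0 ->
    dot (grad (phi f eps) x) (diag x *m d') = dot r d'.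
  move=> hd'; rewrite dot_scaled_grad rE [in RHS]dotC dotD dotC.
  suff -> : dot d' (- ((A *m diag x)^T *m lambda)) = 0 by rewrite addr0.
  by rewrite dotE mulmxN mulmxA -trmx_mul hd' trmx0 mul0mx oppr0 mxE.
have hd : A *m diag x *m d = 0 by rewrite -scalemxAr Br0 scaler0.
have vd : dot (grad (phi f eps) x) (diag x *m d) = - (beta * norm2 r).
  rewrite dotr // dotZ -sqr_norm2 mulNr; congr (- _).
  have [->|r0] := eqVneq (norm2 r) 0; first by rewrite expr0n /= !mulr0.
  by rewrite expr2 mulrA divfK.
split=> //; split; first split=> //.
  rewrite norm2Z normrN ger0_norm ?divr_ge0 ?norm2_ge0 ?(ltW b0) //.
  have [->|r0] := eqVneq (norm2 r) 0; first by rewrite mulr0 ltW.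
  by rewrite divfK.
by move=> d' [hd' nd']; rewrite vd (dotr d' hd') dot_ge_norm2.
Qed.

Lemma row_free_scaled x : row_free A -> positive x -> row_free (A *m diag x).
Proof.
move=> Afree x0; have du : row_free (diag x).
  rewrite row_free_unit unitmxE det_diag unitfE; apply/prodf_neq0 => i _.
  by rewrite mxE gt_eqF.
by rewrite /row_free mxrankMfree.
Qed.

Lemma exists_projection x : row_free A -> positive x ->
  exists r (lambda : 'cV[R]_m),
    r = scaled_grad x - (A *m diag x)^T *m lambda /\ A *m diag x *m r = 0.
Proof.
move=> Afree x0; set B := A *m diag x.
have Bu : B *m B^T \in unitmx by apply/gram_unitmx/row_free_scaled.
(* The solution of the normal equations [B B^T lambda = B u], with u the scaled gradient. *)
pose lambda := invmx (B *m B^T) *m (B *m scaled_grad x).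
exists (scaled_grad x - B^T *m lambda), lambda; split=> //.
by rewrite mulmxBr (mulmxA B B^T) mulKVmx ?subrr.
Qed.

Lemma next_iterate_coord x d i : next_iterate x d i 0 = x i 0 * (1 + d i 0).
Proof. by rewrite mxE mul_diagE mulrDr mulr1. Qed.

Lemma abs_step_le x d i : trust_region A beta x d -> - beta <= d i 0 <= beta.
Proof.
by move=> [_ hd]; rewrite -ler_norml; apply: le_trans (abs_coord_le_norm2 d i) hd.
Qed.

Lemma next_iterate_interior x d : interior_feasible A b x ->
  trust_region A beta x d -> interior_feasible A b (next_iterate x d).
Proof.
have /andP[b0 b1] := beta01.
move=> [Ax x0] hd; split; last first.
  move=> i; rewrite next_iterate_coord mulr_gt0 //.
  by have /andP[h _] := abs_step_le i hd; lra.
by case: hd => hd _; rewrite /= mulmxDr mulmxA hd addr0.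
Qed.

Hypothesis eps_gt0 : 0 < eps.
Hypothesis f_diff : forall x, positive x -> differentiable f x.

Lemma scaled_gradE x i : positive x ->
  scaled_grad x i 0 = x i 0 * grad f x i 0 - eps.
Proof.
move=> x0; rewrite mul_diagE grad_phi //; last exact: f_diff.
rewrite mxE mulrBr; congr (_ - _).
by rewrite mulrCA divff ?mulr1 // gt_eqF.
Qed.

Hypothesis ln_beta : - beta - beta ^+ 2 <= ln (1 - beta).
Hypothesis f_concave : concave_on (interior_feasible A b) f.
Hypothesis A_free : row_free A.

Lemma phi_step_le x d : interior_feasible A b x -> trust_region A beta x d ->
  phi f eps (next_iterate x d) - phi f eps x <=
    dot (grad (phi f eps) x) (diag x *m d) + eps * beta ^+ 2.
Proof.
move=> ix hd; have [_ x0] := ix; have /andP[b0 b1] := beta01.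
have fx := f_concave ix (next_iterate_interior ix hd).
have {}fx : f (next_iterate x d) - f x <= dot (grad f x) (diag x *m d).
  by rewrite lerBlDl -[diag x *m d](addKr x) [- x + _]addrC.
rewrite /phi.
have -> : dot (grad (phi f eps) x) (diag x *m d) =
    dot (grad f x) (diag x *m d) - eps * \sum_i d i 0.
  rewrite dot_scaled_grad /dot mulr_sumr -sumrB; apply: eq_bigr => i _.
  rewrite (_ : scaled_grad x i 0 = x i 0 * grad f x i 0 - eps).
    by rewrite mul_diagE mulrBl; congr (_ - _); rewrite mulrCA mulrA.
  exact: scaled_gradE.
suff : \sum_i ln (x i 0) + \sum_i d i 0 - beta ^+ 2 <=
       \sum_i ln (next_iterate x d i 0).
  rewrite -(ler_pM2l eps_gt0) => h; lra.
(* The errors of the logarithmic bound add up to [dot d d], which is at most [beta ^+ 2] whatever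
   the dimension. *)
apply: (@le_trans _ _ (\sum_i (ln (x i 0) + (d i 0 - d i 0 ^+ 2)))).
  rewrite !big_split /= sumrN -addrA lerD2l lerD2l lerN2.
  case: hd => _ hd; have b0' := ltW b0.
  have : dot d d <= beta ^+ 2 by rewrite -sqr_norm2 ler_pXn2r ?nnegrE ?norm2_ge0.
  by apply: le_trans; apply: ler_sum => i _; rewrite expr2.
apply: ler_sum => i _; rewrite next_iterate_coord.
have hi := abs_step_le i hd.
have [hi1 _] := andP hi.
rewrite lnM ?posrE //; last by lra.
by rewrite lerD2l; apply: ln_quadratic_lb hi.
Qed.

(** Taking s to be the gradient of the Lagrangian makes the stationarity residual vanish, and then
    [x_i s_i = r_i + eps]. As every [|r_i|] is below [eps], this lies strictly between 0 and
    [2 * eps], which gives both the sign of s and complementarity. *)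
Lemma stopping_kkt x d : interior_feasible A b x ->
  trust_region_solution A f eps beta x d -> stopping_test f eps beta x d ->
  kkt_point A b f (2 * eps) x.
Proof.
move=> ix [hd dopt] stop; have [_ x0] := ix; have /andP[b0 b1] := beta01.
have [r [lambda [rE Br0]]] := exists_projection A_free x0.
have [[hd' _] vd'] := projected_gradient_step rE Br0.
have h1 := phi_step_le ix hd.
have {dopt} h2 := dopt _ hd'.
rewrite vd' in h2; rewrite /stopping_test in stop.
(* The test gives [- eps beta (1 - beta) < - beta |r| + eps beta^2], that is
   [beta |r| < eps beta]. *)
have r_lt : norm2 r < eps.
  by rewrite -(ltr_pM2l b0) mulrC; lra.
pose s := grad f x + A^T *m (- lambda).
have sE i : x i 0 * s i 0 = r i 0 + eps.
  have -> : r i 0 = x i 0 * grad f x i 0 - eps - x i 0 * (A^T *m lambda) i 0.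
    rewrite rE mxE (scaled_gradE i x0) trmx_mul tr_diag_mx -/(diag x) -mulmxA.
    by rewrite [X in _ + X]mxE mul_diagE.
  by rewrite /s mulmxN mxE [X in _ + X]mxE mulrDr mulrN; ring.
split=> //; exists (- lambda), s; split.
- move=> i; have := le_lt_trans (abs_coord_le_norm2 r i) r_lt.
  rewrite ltr_norml => /andP[h _].
  by rewrite -(pmulr_rge0 _ (x0 i)) sE; lra.
- by rewrite subrr normr0 mulr_ge0 // ltW.
- move=> i; have := le_lt_trans (abs_coord_le_norm2 r i) r_lt.
  rewrite ltr_norml => /andP[h h']; rewrite sE ger0_norm; lra.
Qed.

End TrustRegion.

(** * Iteration count and quality of the returned point *)

Section Termination.
Variables (R : realType) (m n : nat).
Variables (A : 'M[R]_(m, n)) (b : 'cV[R]_m) (f : 'cV[R]_n -> R).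
Variables (eps beta C0 : R) (x0 xstar : 'cV[R]_n).
Let T := iteration_limit f eps beta x0 xstar C0.

(** The [+ 1] accounts for a last iteration begun at some t < T', and the maximum with 0 for a
    negative limit, where no iteration is performed. *)
Lemma returns_count (T' : R) t x N y : returns A f eps beta T' t x N y ->
  t%:R <= Num.max 0 (T' + 1) -> N%:R <= Num.max 0 (T' + 1).
Proof.
elim=> {t x N y} [t x _ //|t x d tT _ _ _|t x d N y tT _ _ _ IH _].
  by rewrite le_max -natr1 lerD2r (ltW tT) orbT.
by apply: IH; rewrite le_max -natr1 lerD2r (ltW tT) orbT.
Qed.

Hypothesis beta01 : 0 < beta < 1.
Hypothesis eps_gt0 : 0 < eps.
Hypothesis f_diff : forall x, positive x -> differentiable f x.
Hypothesis ln_beta : - beta - beta ^+ 2 <= ln (1 - beta).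
Hypothesis f_concave : concave_on (interior_feasible A b) f.
Hypothesis A_free : row_free A.
Hypothesis x0_center :
  forall x, interior_feasible A b x -> barrier x0 - C0 <= barrier x.

(** The invariant is that t iterations have lowered [phi] by at least t times the threshold. Once t
    reaches T the decrease is at least [f x0 - f xstar + (C0 - 1) * eps]; the barrier accounts for
    at most [C0 * eps] of it, which leaves [f x - f xstar <= eps]. *)
Lemma returns_quality t x N y : returns A f eps beta T t x N y ->
  interior_feasible A b x ->
  phi f eps x - phi f eps x0 <= - (t%:R * (eps * beta * (1 - beta))) ->
  kkt_point A b f (2 * eps) y \/ f y - f xstar <= eps.
Proof.
have /andP[b0 b1] := beta01.
have theta_gt0 : 0 < eps * beta * (1 - beta) by rewrite !mulr_gt0 // subr_gt0.
elim=> {t x N y} [t x Tt ix hphi|t x d _ hd stop ix _|t x d N y _ hd nstop _ IH ix hphi].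
- right; move: Tt; rewrite /T /iteration_limit ler_pdivrMr // => Tt.
  have h : phi f eps x - phi f eps x0 <= - (f x0 - f xstar + (C0 - 1) * eps) by lra.
  have phiE z : phi f eps z = f z + eps * barrier z.
    by rewrite /phi /barrier mulrN.
  have := x0_center ix; rewrite -(ler_pM2l eps_gt0) => hc.
  rewrite !phiE in h; lra.
- by left; apply: stopping_kkt ix hd stop.
- apply: IH; first by case: hd => hd _; apply: next_iterate_interior ix hd.
  move/negP: nstop; rewrite -leNgt => nstop.
  by rewrite -natr1; lra.
Qed.

End Termination.

(** * Straight-line programs *)

Section StraightLine.
Variables (R : realType) (n : nat).
Implicit Types (f : 'cV[R]_n -> R) (P Q : program R) (s : memory R) (l a : nat).

Fixpoint straight P : bool :=
  match P with
  | Seq P Q => straight P && straight Q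
  | IfLe _ _ _ _ | WhileLt _ _ _ => false
  | _ => true
  end.

(** The values at branches and loops are placeholders, as [run] is related to [exec] for [straight]
    programs only. *)
Fixpoint run f P s : memory R :=
  match P with
  | Skip => s
  | Instr c => step s c
  | Sqrt r i => store s r (Num.sqrt (s i))
  | Ln r i => store s r (ln (s i))
  | Value r p => store s r (f (read_vec n s p))
  | Gradient r p => write_vec s r (grad f (read_vec n s p))
  | Seq P Q => run f Q (run f P s)
  | IfLe _ _ _ _ | WhileLt _ _ _ => s
  end.

Fixpoint cost P : nat :=
  match P with
  | Skip => 0
  | Value _ _ | Gradient _ _ => n
  | Seq P Q => cost P + cost Q
  | _ => 1
  end.

Lemma exec_straight f P s : straight P -> exec f P s (run f P s) (cost P).
Proof.
elim: P s => //=; try by move=> *; constructor.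
by move=> P IHP Q IHQ s /andP[hP hQ]; apply: ExecSeq (IHP _ hP) (IHQ _ hQ).
Qed.

(** Memory is allocated like a stack: a fragment writes from its pointer l on only, so results
    stored below l survive it. *)
Definition frame l P := forall f s a, (a < l)%N -> run f P s a = s a.

Definition code l P (c : R) := [/\ straight P, (cost P)%:R <= c & frame l P].

Lemma code_seq l l' P Q c d :
  code l P c -> code l' Q d -> (l <= l')%N -> code l (Seq P Q) (c + d).
Proof.
move=> [sP cP fP] [sQ cQ fQ] ll'; split; first by rewrite /= sP sQ.
  by rewrite /= natrD lerD.
by move=> f s a al /=; rewrite fQ ?fP // (leq_trans al).
Qed.

Lemma code_le l P c d : code l P c -> c <= d -> code l P d.
Proof. by move=> [sP cP fP] cd; split=> //; apply: le_trans cd. Qed.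

Lemma storeE s r v a : store s r v a = if a == r then v else s a.
Proof. by []. Qed.

Inductive binop := OpAdd | OpSub | OpMul | OpDiv.

Inductive expr :=
| Cell of nat
| Lit of R
| Bin of binop & expr & expr
| LnE of expr
| SqrtE of expr.

Definition op_instr o : nat -> nat -> nat -> instr R :=
  match o with
  | OpAdd => @Add R | OpSub => @Defs.Sub R | OpMul => @Mul R | OpDiv => @Div R
  end.

Definition op_val o (x y : R) : R :=
  match o with
  | OpAdd => x + y | OpSub => x - y | OpMul => x * y | OpDiv => x / y
  end.

Fixpoint eval s e : R :=
  match e with
  | Cell a => s a
  | Lit c => c
  | Bin o e1 e2 => op_val o (eval s e1) (eval s e2)
  | LnE e => ln (eval s e)
  | SqrtE e => Num.sqrt (eval s e)
  end.

Fixpoint below l e : bool :=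
  match e with
  | Cell a => (a < l)%N
  | Lit c => true
  | Bin o e1 e2 => below l e1 && below l e2
  | LnE e | SqrtE e => below l e
  end.

(** The exact running time of [compile]. Reading a cell costs 2 since the machine has no move
    instruction: a zero is loaded and the cell is added to it. *)
Fixpoint esize e : nat :=
  match e with
  | Cell a => 2
  | Lit c => 1
  | Bin o e1 e2 => esize e1 + esize e2 + 1
  | LnE e | SqrtE e => esize e + 1
  end.

(* Evaluation on a stack: the value of e is left in cell l, and only the cells
   from l on are overwritten. *)
Fixpoint compile e l : program R :=
  match e with
  | Cell a => Seq (Instr (Const l 0)) (Instr (Add R l l a))
  | Lit c => Instr (Const l c)
  | Bin o e1 e2 =>
      Seq (compile e1 l) (Seq (compile e2 l.+1) (Instr (op_instr o l l l.+1)))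
  | LnE e => Seq (compile e l) (Ln R l l)
  | SqrtE e => Seq (compile e l) (Sqrt R l l)
  end.

Lemma below_leq l l' e : (l <= l')%N -> below l e -> below l' e.
Proof.
move=> ll'; elim: e => //= [a al|o e1 IH1 e2 IH2 /andP[h1 h2]].
  exact: leq_trans ll'.
by rewrite IH1 ?IH2.
Qed.

Lemma eval_agree l s s' e : below l e ->
  (forall a, (a < l)%N -> s a = s' a) -> eval s e = eval s' e.
Proof.
move=> + hs; elim: e => //= [op e1 IH1 e2 IH2 /andP[h1 h2]|e IH h|e IH h].
- by rewrite IH1 ?IH2.
- by rewrite IH.
- by rewrite IH.
Qed.

Lemma straight_compile e l : straight (compile e l).
Proof. by elim: e l => //= [op e1 IH1 e2 IH2 l|e IH l|e IH l]; rewrite ?IH1 ?IH2 ?IH. Qed.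

Lemma cost_compile e l : cost (compile e l) = esize e.
Proof.
by elim: e l => //= [op e1 IH1 e2 IH2 l|e IH l|e IH l]; rewrite ?IH1 ?IH2 ?IH ?addnA.
Qed.

Lemma step_op s o d i j a :
  step s (op_instr o d i j) a = if a == d then op_val o (s i) (s j) else s a.
Proof. by case: o. Qed.

Lemma frame_compile e l : frame l (compile e l).
Proof.
elim: e l => [k|c|o e1 IH1 e2 IH2|e IH|e IH] l f s a al /=;
  rewrite ?step_op ?storeE ?(ltn_eqF al) //.
- by rewrite IH2 ?IH1 // ltnW.
- by rewrite IH.
- by rewrite IH.
Qed.

Lemma run_compile e l f s : below l e -> run f (compile e l) s l = eval s e.
Proof.
elim: e l s => [k|c|o e1 IH1 e2 IH2|e IH|e IH] l s /= hl;
  rewrite ?step_op ?storeE ?eqxx //; last 2 first.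
- by rewrite IH.
- by rewrite IH.
- by rewrite (ltn_eqF hl) add0r.
- have /andP[h1 h2] := hl; have h2' := below_leq (leqnSn l) h2.
  (* The second operand is evaluated one cell higher, so the first value stays in l; conversely the
     first evaluation leaves the cells read by the second unchanged. *)
  rewrite IH2 // (frame_compile e2) // IH1 //; congr op_val.
  by apply: eval_agree h2 _ => a al; rewrite frame_compile.
Qed.

(** Entries are filled in increasing order, so the evaluation stack of an entry spills only over
    cells whose entries are still to be computed. *)
Fixpoint tab l c (e : nat -> expr) : program R :=
  if c is c'.+1 then Seq (tab l c' e) (compile (e c') (l + c')) else Skip R.

Lemma frame_tab l c e : frame l (tab l c e).
Proof.
move=> f s a al; elim: c => //= c IH.
by rewrite frame_compile ?IH // ltn_addr.
Qed.

Lemma tab_code l c e K :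
  (forall i, (i < c)%N -> (esize (e i) <= K)%N) -> code l (tab l c e) (c * K)%:R.
Proof.
move=> hK; split; [|rewrite ler_nat|exact: frame_tab].
  by elim: c {hK} => //= c ->; rewrite straight_compile.
elim: c hK => //= c IH hK; rewrite mulSn addnC leq_add //.
  by rewrite cost_compile hK.
by apply: IH => i ic; apply: hK; rewrite ltnW.
Qed.

Lemma run_tab l c e f s i : (forall i, (i < c)%N -> below l (e i)) -> (i < c)%N ->
  run f (tab l c e) s (l + i)%N = eval s (e i).
Proof.
elim: c => //= c IH he; rewrite ltnS leq_eqVlt => /predU1P[->|ic].
  rewrite run_compile; last by apply: below_leq (he c _) => //; rewrite leq_addr.
  by apply: eval_agree (he c _) _ => // a al; rewrite frame_tab.
by rewrite frame_compile ?ltn_add2l // IH // => k kc; apply: he; rewrite ltnW.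
Qed.

Definition esum k (g : nat -> expr) : expr :=
  foldr (fun j acc => Bin OpAdd (g j) acc) (Lit 0) (iota 0 k).

Lemma eval_esum s k g : eval s (esum k g) = \sum_(j < k) eval s (g j).
Proof.
rewrite /esum -(big_mkord xpredT (fun j => eval s (g j))) /index_iota subn0.
elim: (iota 0 k) => [|j r IH] /=; first by rewrite big_nil.
by rewrite big_cons IH.
Qed.

Lemma below_esum l k g : (forall j, (j < k)%N -> below l (g j)) -> below l (esum k g).
Proof.
move=> hg; have : all (fun j => (j < k)%N) (iota 0 k).
  by apply/allP => j; rewrite mem_iota add0n.
by rewrite /esum; elim: (iota 0 k) => //= j r IH /andP[jk hr]; rewrite hg ?IH.
Qed.

Lemma esize_esum k g K : (forall j, (j < k)%N -> (esize (g j) <= K)%N) ->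
  (esize (esum k g) <= k * K.+1 + 1)%N.
Proof.
move=> hg; have : all (fun j => (j < k)%N) (iota 0 k).
  by apply/allP => j; rewrite mem_iota add0n.
rewrite -[X in (_ <= X * _ + 1)%N](size_iota 0 k) /esum.
elim: (iota 0 k) => //= j r IH /andP[jk hr].
by have := hg _ jk; have := IH hr; rewrite mulSn; lia.
Qed.

Definition rowmajor (p q i j : nat) : nat := p + i * q + j.

Lemma rowmajor_lt p k q i j :
  (i < k)%N -> (j < q)%N -> (rowmajor p q i j < p + k * q)%N.
Proof. by rewrite /rowmajor => ik jq; nia. Qed.

Definition tabmx l p q (e : nat -> nat -> expr) : program R :=
  tab l (p * q) (fun t => e (t %/ q)%N (t %% q)%N).

Lemma tabmx_code l p q e K :
  (forall i j, (i < p)%N -> (j < q)%N -> (esize (e i j) <= K)%N) ->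
  code l (tabmx l p q e) (p * q * K)%:R.
Proof.
move=> hK; apply: tab_code => t tpq.
have q0 : (0 < q)%N by case: q tpq {hK} => //; rewrite muln0.
by apply: hK; rewrite ?ltn_divLR ?ltn_mod.
Qed.

Lemma run_tabmx l p q e f s i j :
  (forall i j, (i < p)%N -> (j < q)%N -> below l (e i j)) ->
  (i < p)%N -> (j < q)%N ->
  run f (tabmx l p q e) s (rowmajor l q i j) = eval s (e i j).
Proof.
move=> he ip jq; have q0 : (0 < q)%N by apply: leq_ltn_trans jq.
rewrite /rowmajor -addnA run_tab.
- by rewrite divnMDl // divn_small // addn0 modnMDl modn_small.
- by move=> t tpq; apply: he; rewrite ?ltn_divLR ?ltn_mod.
- by have := rowmajor_lt 0 ip jq; rewrite /rowmajor !add0n.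
Qed.

Definition shift_instr l (c : instr R) : instr R :=
  match c with
  | Const r v => Const (l + r) v
  | Add r i j => Add R (l + r) (l + i) (l + j)
  | Defs.Sub r i j => Defs.Sub R (l + r) (l + i) (l + j)
  | Mul r i j => Mul R (l + r) (l + i) (l + j)
  | Div r i j => Div R (l + r) (l + i) (l + j)
  end.

Definition shifted l (prog : seq (instr R)) : program R :=
  foldr (fun c => Seq (Instr (shift_instr l c))) (Skip R) prog.

(** Relocation by l amounts to running the original program on the memory seen from address l on,
    whatever that memory contains. *)
Lemma run_shifted f l prog s a :
  run f (shifted l prog) s (l + a)%N = foldl (@step R) (fun a => s (l + a)%N) prog a.
Proof.
elim: prog s => //= c prog IH s; rewrite IH; congr (foldl _ _ _ _).
apply/funext => k; case: c => [r v|r i j|r i j|r i j|r i j] /=;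
  by rewrite !storeE eqn_add2l.
Qed.

Lemma shifted_code l prog : code l (shifted l prog) (size prog)%:R.
Proof.
split; [by elim: prog|rewrite ler_nat; by elim: prog|].
move=> f s a al; elim: prog s => //= c prog IH s; rewrite IH.
by case: c => [r v|r i j|r i j|r i j|r i j] /=; rewrite storeE ltn_eqF // ltn_addr.
Qed.

(** Addresses are given by an arbitrary map v, so blocks and transposes of a stored matrix are
    themselves stored matrices and need no copying. *)
Definition holds p q s (v : nat -> nat -> nat) (M : 'M[R]_(p, q)) :=
  forall (i : 'I_p) (j : 'I_q), s (v i j) = M i j.

Definition under p q l (v : nat -> nat -> nat) :=
  forall i j, (i < p)%N -> (j < q)%N -> (v i j < l)%N.

Lemma under_leq p q l l' v : (l <= l')%N -> under p q l v -> under p q l' v.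
Proof. by move=> ll' hv i j ip jq; apply: leq_trans (hv i j ip jq) ll'. Qed.

Lemma under_rowmajor l p q l' : (l + p * q <= l')%N -> under p q l' (rowmajor l q).
Proof. by move=> h i j ip jq; apply: leq_trans (rowmajor_lt l ip jq) h. Qed.

Lemma holds_frame p q l P f s v (M : 'M[R]_(p, q)) :
  frame l P -> under p q l v -> holds s v M -> holds (run f P s) v M.
Proof. by move=> fP hv hM i j; rewrite fP ?hM // hv. Qed.

Fixpoint copy (dst src k : nat) : program R :=
  if k is k'.+1 then
    Seq (copy dst src k') (Seq (Instr (Const (dst + k') 0))
      (Instr (Add R (dst + k') (dst + k') (src + k'))))
  else Skip R.

Lemma straight_copy dst src k : straight (copy dst src k).
Proof. by elim: k => //= k ->. Qed.

Lemma cost_copy dst src k : cost (copy dst src k) = (k * 2)%N.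
Proof. by elim: k => //= k ->; rewrite mulSn addnC. Qed.

(** Since the target range ends before the source begins, no source cell is overwritten before it is
    read. *)
Lemma run_copy f dst src k s a : (dst + k <= src)%N ->
  run f (copy dst src k) s a =
  if (dst <= a < dst + k)%N then s (src + (a - dst))%N else s a.
Proof.
elim: k s a => [|k IH] s a h /=; first by rewrite addn0; case: ifP => //; lia.
have h' : (dst + k <= src)%N by lia.
rewrite !storeE eqxx add0r (_ : (src + k == dst + k)%N = false); last by lia.
rewrite !IH // (_ : (dst <= src + k < dst + k)%N = false); last by lia.
case: (eqVneq a (dst + k)%N) => [->|ne].
  by rewrite (_ : (dst <= dst + k < _)%N = true) ?addKn //; lia.
by rewrite (_ : (dst <= a < dst + k.+1)%N = (dst <= a < dst + k)%N) //; lia.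
Qed.

Lemma compile_code l e : code l (compile e l) (esize e)%:R.
Proof.
split; [exact: straight_compile|by rewrite cost_compile|exact: frame_compile].
Qed.

Lemma value_code l src : code l (Value R l src) n%:R.
Proof. by split=> // f s a al /=; rewrite storeE ltn_eqF. Qed.

Lemma read_vec_eq s src (x : 'cV[R]_n) :
  (forall i : 'I_n, s (src + i)%N = x i 0) -> read_vec n s src = x.
Proof. by move=> h; apply/colP => i; rewrite mxE. Qed.

End StraightLine.

(** * Fast inversion of Gram matrices *)

Section BlockInverse.
Variable R : realFieldType.

Definition posdef p (M : 'M[R]_p) :=
  forall v : 'rV[R]_p, v != 0 -> 0 < (v *m M *m v^T) 0 0.

Lemma posdef_unitmx p (M : 'M[R]_p) : posdef M -> M \in unitmx.
Proof.
move=> hM; rewrite -row_free_unit -kermx_eq0; apply/eqP/row_matrixP => i.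
rewrite row0; apply/eqP/negPn/negP => /hM.
by rewrite -row_mul mulmx_ker row0 mul0mx mxE ltxx.
Qed.

Lemma posdef_ulsubmx p q (A : 'M[R]_p) (B : 'M[R]_(p, q)) (C : 'M[R]_(q, p))
    (D : 'M[R]_q) :
  posdef (block_mx A B C D) -> posdef A.
Proof.
move=> hM v v0; have := hM (row_mx v 0).
rewrite mul_row_block !mul0mx !addr0 tr_row_mx mul_row_col trmx0 mulmx0 addr0.
by apply; apply: contra_neq v0; rewrite -(row_mx0 R 1 p q) => /eq_row_mx[].
Qed.

(** The test vector [(- v C A^-1, v)] is chosen so that its product with the block matrix vanishes
    in the first block; the quadratic form then reduces to that of the Schur complement at v. *)
Lemma posdef_schur p q (A : 'M[R]_p) (B : 'M[R]_(p, q)) (C : 'M[R]_(q, p))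
    (D : 'M[R]_q) :
  posdef (block_mx A B C D) -> posdef (D - C *m (invmx A *m B)).
Proof.
move=> hM; have Au := posdef_unitmx (posdef_ulsubmx hM); move=> v v0.
have := hM (row_mx (- (v *m C *m invmx A)) v).
rewrite mul_row_block !mulNmx mulmxKV // addNr tr_row_mx mul_row_col mul0mx add0r.
have -> : - (v *m C *m invmx A *m B) + v *m D = v *m (D - C *m (invmx A *m B)).
  by rewrite mulmxBr addrC !mulmxA.
by apply; apply: contra_neq v0; rewrite -(row_mx0 R 1 p q) => /eq_row_mx[].
Qed.

(** The right-hand side is checked to be a left inverse, which is enough for a square matrix. *)
Lemma invmx_block_schur p q (A : 'M[R]_p) (B : 'M[R]_(p, q)) (C : 'M[R]_(q, p))
    (D : 'M[R]_q) :
  let E := invmx A *m B in let F := C *m invmx A in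
  let S := D - C *m E in
  A \in unitmx -> S \in unitmx ->
  invmx (block_mx A B C D) =
    block_mx (invmx A + E *m invmx S *m F) (- (E *m invmx S))
             (- (invmx S *m F)) (invmx S).
Proof.
move=> E F S Au Su; set X := block_mx (invmx A + _) _ _ _.
have DE : D = S + C *m E by rewrite subrK.
have FA : F *m A = C by rewrite mulmxKV.
have FB : F *m B = C *m E by rewrite -mulmxA.
have EB : invmx A *m B = E by [].
clearbody F S E.
have XM : X *m block_mx A B C D = 1%:M.
  rewrite /X mulmx_block !mulmxDl !mulNmx -!mulmxA !FA !FB mulVmx // EB.
  rewrite addrK DE !mulmxDr mulVmx // mulmx1 addNr.
  by rewrite subrr addrCA addNr addr0 -scalar_mx_block.
have [_ Mu] := mulmx1_unit XM.
by rewrite -[RHS](mulmxK Mu) XM mul1mx.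
Qed.

End BlockInverse.

(** * Padding the Gram matrix *)

Section PaddedGram.
Variables (R : realFieldType) (p m n : nat) (L : 'M[R]_(p, m)) (B : 'M[R]_(m, n)).
Hypotheses (L_isometry : L^T *m L = 1%:M) (B_free : row_free B).

Let G := 1%:M - L *m L^T + L *m B *m (L *m B)^T.

(* The first two terms of G form an orthogonal projection. *)
Lemma posdef_padded_gram : posdef G.
Proof.
move=> v v0; pose K := 1%:M - L *m L^T.
have KL : K *m L = 0 by rewrite mulmxBl mul1mx -mulmxA L_isometry mulmx1 subrr.
have KT : K^T = K by rewrite raddfB /= trmx1 trmx_mul trmxK.
have KK : K *m K = K by rewrite {2}/K mulmxBr mulmx1 mulmxA KL mul0mx subr0.
have vG : (v *m G *m v^T) 0 0 =
    (v *m K *m (v *m K)^T) 0 0 + (v *m (L *m B) *m (v *m (L *m B))^T) 0 0.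
  rewrite /G -/K mulmxDr mulmxDl mxE [(v *m K)^T]trmx_mul KT; congr (_ + _).
    by rewrite mulmxA -(mulmxA v K K) KK.
  by rewrite [(v *m (L *m B))^T]trmx_mul !mulmxA.
rewrite vG lt_def addr_ge0 ?mulmx_tr_rV_ge0 // andbT; apply: contra_neq v0 => /eqP.
rewrite paddr_eq0 ?mulmx_tr_rV_ge0 // => /andP[/eqP h1 /eqP h2].
have {}h1 := mulmx_tr_rV_eq0 h1; have {}h2 := mulmx_tr_rV_eq0 h2.
have vL : v *m L = 0.
  by apply: (row_free_inj B_free); rewrite -mulmxA h2 mul0mx.
by move: h1; rewrite mulmxBr mulmx1 mulmxA vL mul0mx subr0.
Qed.

(** Since [L^T G = B (L B)^T] and [G w = L B u], multiplying by [L^T] gives [B (L B)^T w = B u].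
    Thus the padded system yields the same kind of projection as the normal equations of B. *)
Lemma padded_projection (u : 'cV[R]_n) :
  let w := invmx G *m (L *m B *m u) in B *m (u - (L *m B)^T *m w) = 0.
Proof.
move=> w; have Gw : G *m w = L *m B *m u.
  exact/mulKVmx/posdef_unitmx/posdef_padded_gram.
have LG : L^T *m G = B *m (L *m B)^T.
  by rewrite mulmxDr mulmxBr mulmx1 !mulmxA L_isometry !mul1mx subrr add0r.
by rewrite mulmxBr mulmxA -LG -mulmxA Gw !mulmxA L_isometry mul1mx subrr.
Qed.

End PaddedGram.

Lemma pid_mx_isometry (R : realFieldType) p m : (m <= p)%N ->
  (pid_mx m : 'M[R]_(p, m))^T *m pid_mx m = 1%:M.
Proof. by move=> mp; rewrite tr_pid_mx mul_pid_mx minnn (minn_idPr mp) pid_mx_1. Qed.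

Lemma mul_pid_mx_rowE (R : realFieldType) p m n (B : 'M[R]_(m, n)) (i : 'I_p) t :
  ((pid_mx m : 'M[R]_(p, m)) *m B) i t =
  if insub (i : nat) is Some i' then B i' t else 0.
Proof.
rewrite mxE; case: insubP => [i' im iE|im].
  rewrite (bigD1 i') //= mxE iE eqxx im mul1r big1 ?addr0 // => j ji.
  by rewrite mxE -iE (inj_eq val_inj) eq_sym (negPf ji) mul0r.
rewrite big1 // => j _; rewrite mxE gtn_eqF ?mul0r //=.
by apply: leq_trans (ltn_ord j) _; rewrite leqNgt.
Qed.

(** Turns the sum of the products of square blocks back into one sum over all columns. *)
Lemma sum_blocks (R : realFieldType) (F : nat -> R) q p :
  \sum_(j < q) \sum_(c < p) F (j * p + c)%N = \sum_(t < q * p) F t.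
Proof.
elim: q => [|q IH]; first by rewrite mul0n !big_ord0.
rewrite big_ord_recr IH -!(big_mkord xpredT F) /= mulSnr.
rewrite [RHS](@big_cat_nat _ _ _ (q * p)) ?leq_addr //=. congr (_ + _).
rewrite -{2}[(q * p)%N]add0n big_addn addKn big_mkord.
by apply: eq_bigr => c _; rewrite addnC.
Qed.

(** * Cost of matrix operations on the register machine *)

Section FastArithmetic.
Variables (R : realType) (omega C : R).
Hypothesis mm_program : forall p : nat, (0 < p)%N ->
  exists2 prog : seq (instr R),
    (size prog)%:R <= C * p%:R `^ omega &
    forall (s : memory R) (M N : 'M[R]_p),
      mx_at s 0 M -> mx_at s (p * p) N ->
      mx_at (foldl (@step R) s prog) (2 * (p * p)) (M *m N).

Let pw (p : nat) : R := p%:R `^ omega.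

Definition dst (c : instr R) : nat :=
  match c with
  | Const r _ | Add r _ _ | Defs.Sub r _ _ | Mul r _ _ | Div r _ _ => r
  end.

Lemma foldl_step_frame (prog : seq (instr R)) s a :
  a \notin [seq dst c | c <- prog] -> foldl (@step R) s prog a = s a.
Proof.
elim: prog s => //= c prog IH s; rewrite inE negb_or => /andP[ac ha].
by rewrite IH //; case: c ac => /= [r ?|r ? ?|r ? ?|r ? ?|r ? ?] /negPf h;
  rewrite storeE h.
Qed.

(* Every cell of the product has to be written, since otherwise it would keep
   its arbitrary initial contents. *)
Lemma sqr_le_pw p : (0 < p)%N -> (p * p)%:R <= C * pw p.
Proof.
move=> p0; have [prog hsize hprog] := mm_program p0.
apply: le_trans hsize; rewrite ler_nat.
rewrite -(size_map dst) -(size_iota (2 * (p * p)) (p * p)).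
apply: uniq_leq_size; first exact: iota_uniq.
move=> a; rewrite mem_iota => /andP[a1 a2]; apply/negPn/negP => ha.
pose s : memory R := fun k => (k == a)%:R.
have hs0 k : (k < 2 * (p * p))%N -> s k = 0.
  by move=> kp; rewrite /s ltn_eqF // (leq_trans kp).
have hM : mx_at s 0 (0 : 'M[R]_p).
  move=> i j; rewrite mxE hs0 //.
  have := rowmajor_lt 0 (ltn_ord i) (ltn_ord j); rewrite /rowmajor; lia.
have hN : mx_at s (p * p) (0 : 'M[R]_p).
  move=> i j; rewrite mxE hs0 //.
  have := rowmajor_lt (p * p) (ltn_ord i) (ltn_ord j); rewrite /rowmajor; lia.
have := hprog s 0 0 hM hN.
have hi : ((a - 2 * (p * p)) %/ p < p)%N by rewrite ltn_divLR //; lia.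
have hj : ((a - 2 * (p * p)) %% p < p)%N by rewrite ltn_mod.
move=> /(_ (Ordinal hi) (Ordinal hj)) /=.
rewrite -addnA -divn_eq subnKC // foldl_step_frame // /s eqxx mul0mx mxE => /eqP.
by rewrite oner_eq0.
Qed.

Lemma C_ge1 : 1 <= C.
Proof. by have := @sqr_le_pw 1 isT; rewrite /pw powR1 mulr1. Qed.

Lemma omega_ge2 : 2 <= omega.
Proof.
rewrite leNgt; apply/negP => om; pose c : R := 2 `^ (2 - omega).
have c1 : 1 < c.
  have e0 : 0 < 2 - omega by rewrite subr_gt0.
  have <- : (1 : R) `^ (2 - omega) = 1 by rewrite powR1.
  by apply: (gt0_ltr_powR e0); rewrite ?nnegrE // ltr1n.
have bound k : c ^+ k <= C.
  have := @sqr_le_pw (2 ^ k) (expn_gt0 _ _); rewrite /pw natrM natrX => h.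
  have h2 : (2 : R) ^+ k * 2 ^+ k = c ^+ k * (2 ^+ k) `^ omega.
    rewrite -!powR_mulrn ?powR_ge0 // /c -!powRrM -!powRD ?pnatr_eq0 ?implybT //.
    by congr (_ `^ _); ring.
  by move: h; rewrite h2 ler_pM2r // powR_gt0 // exprn_gt0.
have bern k : 1 + k%:R * (c - 1) <= c ^+ k.
  elim: k => [|k IH]; first by rewrite mul0r addr0 expr0.
  rewrite exprS -natr1; have k0 : 0 <= k%:R :> R by [].
  have := ler_wpM2l (ltW (lt_trans ltr01 c1)) IH.
  apply: le_trans; have := mulr_ge0 k0 (sqr_ge0 (c - 1)); nra.
have [k hk] : exists k : nat, C / (c - 1) < k%:R.
  by exists (Num.truncn (C / (c - 1))).+1; rewrite truncnS_gt.
have := le_trans (bern k) (bound k); move: hk.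
rewrite ltr_pdivrMr ?subr_gt0 //; lra.
Qed.

(** This growth makes the cost of two half-size inversions a fixed fraction of the full cost, so the
    recursion gains no logarithmic factor. *)
Lemma pw_double p : 4 * pw p <= pw (p + p).
Proof.
rewrite /pw addnn -mul2n natrM powRM //; apply: ler_wpM2r; first exact: powR_ge0.
have -> : (4 : R) = 2 `^ 2 by rewrite powR_mulrn // expr2 -natrM.
by rewrite ler_powR ?omega_ge2 // ler1n.
Qed.

Variable n : nat.
Implicit Types (v w : nat -> nat -> nat) (f : 'cV[R]_n -> R).

(** The factors are first gathered at l and [l + p * p], the layout expected by the multiplication
    program. Gathering costs [4 p^2 <= 4 C pw p], hence the factor 5. *)
Lemma mul_code p l v w : (0 < p)%N -> under p p l v -> under p p l w ->
  exists P o, [/\ (l <= o)%N, code n l P (5 * C * pw p) &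
    forall f s (M N : 'M[R]_p), holds s v M -> holds s w N ->
      holds (run f P s) (rowmajor o p) (M *m N)].
Proof.
move=> p0 hv hw; have [prog hsize hprog] := mm_program p0.
pose P1 := tabmx l p p (fun i j => Cell R (v i j)).
pose P2 := tabmx (l + p * p) p p (fun i j => Cell R (w i j)).
have c1 : code n l P1 (p * p * 2)%:R by exact: tabmx_code.
have c2 : code n (l + p * p) P2 (p * p * 2)%:R by exact: tabmx_code.
have c3 := shifted_code n l prog.
exists (Seq (Seq P1 P2) (shifted l prog)), (l + 2 * (p * p))%N.
split; first exact: leq_addr.
  apply: code_le (code_seq (code_seq c1 c2 (leq_addr _ _)) c3 (leqnn _)) _.
  have := sqr_le_pw p0; rewrite !natrM -/(pw p) in hsize *; lra.
move=> f s M N hM hN i j /=.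
set s2 := run f P2 _.
have hM2 : mx_at (fun a => s2 (l + a)%N) 0 M.
  move=> i' j'; rewrite add0n addnA /s2; case: c2 => _ _ ->; last first.
    exact: rowmajor_lt.
  rewrite [LHS](run_tabmx (q := p)) //= => i1 j1 h1 h2; exact: hv.
have hN2 : mx_at (fun a => s2 (l + a)%N) (p * p) N.
  move=> i' j'; rewrite !addnA /s2 [LHS](run_tabmx (q := p)) //=.
    case: c1 => _ _ ->; first exact: hN.
    exact: hw.
  by move=> i1 j1 h1 h2; apply: leq_trans (hw _ _ h1 h2) (leq_addr _ _).
have -> : rowmajor (l + 2 * (p * p)) p i j = (l + (2 * (p * p) + i * p + j))%N.
  by rewrite /rowmajor !addnA.
by rewrite run_shifted; apply: hprog hM2 hN2 _ _.
Qed.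

(** Defined by doubling so that a matrix of size [dsz k.+1] is, up to conversion, a 2 by 2 block
    matrix with blocks of size [dsz k]. *)
Fixpoint dsz k : nat := if k is k'.+1 then dsz k' + dsz k' else 1.

Lemma dszE k : dsz k = (2 ^ k)%N.
Proof. by elim: k => //= k ->; rewrite expnS mul2n addnn. Qed.

Lemma dsz_gt0 k : (0 < dsz k)%N.
Proof. by rewrite dszE expn_gt0. Qed.

(** Block inversion through the Schur complement: two recursive inversions and six products of half
    size. The base case is a division by the only entry, nonzero by positive definiteness. *)
Lemma inverse_code k l v : under (dsz k) (dsz k) l v ->
  exists P o, [/\ (l <= o)%N, code n l P (34 * C * pw (dsz k)) &
    forall f s (M : 'M[R]_(dsz k)), posdef M -> holds s v M ->
      holds (run f P s) (rowmajor o (dsz k)) (invmx M)].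
Proof.
elim: k l v => [|k IH] l v hv.
  pose e (i j : nat) := Bin OpDiv (Lit 1) (Cell R (v i j)).
  exists (tabmx l 1 1 e), l; split=> //.
    apply: code_le (tabmx_code _ _ (K := 4) _) _ => //.
    by rewrite /pw /= powR1; have := C_ge1; lra.
  move=> f s M pdM hM i j.
  have i1 : (i < 1)%N := ltn_ord i; have j1 : (j < 1)%N := ltn_ord j.
  rewrite (run_tabmx (p := 1) (q := 1)) //=.
  rewrite (hM i j) !ord1.
  have Mu := posdef_unitmx pdM.
  have := mulmxV Mu => /matrixP/(_ 0 0); rewrite !mxE big_ord1 eqxx => h.
  have M0 : M 0 0 != 0 by apply/eqP => M0; move/eqP: h; rewrite M0 mul0r eq_sym oner_eq0.
  by apply: (mulfI M0); rewrite h div1r divff.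
rewrite /= in hv *; set h := dsz k in IH hv *.
have h0 : (0 < h)%N by exact: dsz_gt0.
pose v12 i j := v i (h + j)%N; pose v21 i j := v (h + i)%N j.
pose v22 i j := v (h + i)%N (h + j)%N.
have hv11 : under h h l v by move=> i j ip jq; apply: hv; lia.
have hv12 : under h h l v12 by move=> i j ip jq; apply: hv; lia.
have hv21 : under h h l v21 by move=> i j ip jq; apply: hv; lia.
have hv22 : under h h l v22 by move=> i j ip jq; apply: hv; lia.
(* With M = [A, B; C, D], the stages compute in turn [A^-1], [E = A^-1 B], [F = C A^-1], [C E],
   [S = D - C E], [S^-1], [E S^-1], [S^-1 F], [E S^-1 F] and the assembled inverse. *)
have [P1 [q1 [lo1 c1 H1]]] := IH l v hv11.
pose l1 := (q1 + h * h)%N; have ll1 : (l <= l1)%N by lia.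
have u1 := under_rowmajor (leqnn l1).
have [P2 [q2 [lo2 c2 H2]]] := mul_code h0 u1 (under_leq ll1 hv12).
pose l2 := (q2 + h * h)%N; have ll2 : (l1 <= l2)%N by lia.
have u2 := under_rowmajor (leqnn l2).
have [P3 [q3 [lo3 c3 H3]]] :=
  mul_code h0 (under_leq (leq_trans ll1 ll2) hv21) (under_leq ll2 u1).
pose l3 := (q3 + h * h)%N; have ll3 : (l2 <= l3)%N by lia.
have u3 := under_rowmajor (leqnn l3).
have [P4 [q4 [lo4 c4 H4]]] :=
  mul_code h0 (under_leq (leq_trans ll1 (leq_trans ll2 ll3)) hv21) (under_leq ll3 u2).
pose l4 := (q4 + h * h)%N; have ll4 : (l3 <= l4)%N by lia.
have u4 := under_rowmajor (leqnn l4).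
pose e5 i j := Bin OpSub (Cell R (v22 i j)) (Cell R (rowmajor q4 h i j)).
pose P5 := tabmx l4 h h e5.
have c5 : code n l4 P5 (h * h * 5)%:R by exact: tabmx_code.
pose l5 := (l4 + h * h)%N; have ll5 : (l4 <= l5)%N by lia.
have u5 := under_rowmajor (leqnn l5).
have [P6 [q6 [lo6 c6 H6]]] := IH l5 _ u5.
pose l6 := (q6 + h * h)%N; have ll6 : (l5 <= l6)%N by lia.
have u6 := under_rowmajor (leqnn l6).
have l26 : (l2 <= l6)%N by lia.
have [P7 [q7 [lo7 c7 H7]]] := mul_code h0 (under_leq l26 u2) u6.
pose l7 := (q7 + h * h)%N; have ll7 : (l6 <= l7)%N by lia.
have u7 := under_rowmajor (leqnn l7).
have l37 : (l3 <= l7)%N by lia.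
have [P8 [q8 [lo8 c8 H8]]] := mul_code h0 (under_leq ll7 u6) (under_leq l37 u3).
pose l8 := (q8 + h * h)%N; have ll8 : (l7 <= l8)%N by lia.
have u8 := under_rowmajor (leqnn l8).
have l38 : (l3 <= l8)%N by lia.
have [P9 [q9 [lo9 c9 H9]]] := mul_code h0 (under_leq ll8 u7) (under_leq l38 u3).
pose l9 := (q9 + h * h)%N; have ll9 : (l8 <= l9)%N by lia.
have u9 := under_rowmajor (leqnn l9).
pose e10 i j :=
  if (i < h)%N then
    if (j < h)%N then
      Bin OpAdd (Cell R (rowmajor q1 h i j)) (Cell R (rowmajor q9 h i j))
    else Bin OpSub (Lit 0) (Cell R (rowmajor q7 h i (j - h)))
  else
    if (j < h)%N then Bin OpSub (Lit 0) (Cell R (rowmajor q8 h (i - h) j))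
    else Cell R (rowmajor q6 h (i - h) (j - h)).
pose P10 := tabmx l9 (h + h) (h + h) e10.
have c10 : code n l9 P10 ((h + h) * (h + h) * 5)%:R.
  by apply: tabmx_code => i j _ _; rewrite /e10; do 2 case: ifP.
exists (Seq P1 (Seq P2 (Seq P3 (Seq P4 (Seq P5 (Seq P6 (Seq P7 (Seq P8
  (Seq P9 P10))))))))), l9.
split; first by lia.
  have := code_seq c1 (code_seq c2 (code_seq c3 (code_seq c4 (code_seq c5 (code_seq c6
    (code_seq c7 (code_seq c8 (code_seq c9 c10 ll9) ll8) ll7) ll6) ll5) ll4) ll3) ll2) ll1.
  move/code_le; apply.
  (* In units of [C * pw h]: 68 for the inversions, 30 for the products, 5 for the subtraction and
     20 for the assembly. The total 123 is below [34 * 4], and [4 * pw h <= pw (h + h)]. *)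
  have := sqr_le_pw h0; have := pw_double h; have := C_ge1.
  rewrite !natrM !natrD; move: (pw h) (pw (h + h)) (h%:R : R) => a b c h1 h2 h3.
  have : C * (4 * a) <= C * b by rewrite ler_pM2l //; lra.
  nra.
move=> f s M pdM hM.
rewrite -(submxK M) in pdM *.
set A := ulsubmx M in pdM *; set B := ursubmx M in pdM *.
set CC := dlsubmx M in pdM *; set D := drsubmx M in pdM *.
have hA : holds s v A.
  by move=> i j; rewrite -[v i j]/(v (lshift h i) (lshift h j)) hM !mxE.
have hB : holds s v12 B.
  by move=> i j; rewrite -[v12 i j]/(v (lshift h i) (rshift h j)) hM !mxE.
have hC : holds s v21 CC.
  by move=> i j; rewrite -[v21 i j]/(v (rshift h i) (lshift h j)) hM !mxE.
have hD : holds s v22 D.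
  by move=> i j; rewrite -[v22 i j]/(v (rshift h i) (rshift h j)) hM !mxE.
have pdA := posdef_ulsubmx pdM; have pdS := posdef_schur pdM.
have inv := invmx_block_schur (posdef_unitmx pdA) (posdef_unitmx pdS).
rewrite /= in inv; rewrite {}inv /=.
set S := D - _ in pdS *.
have [_ _ f1] := c1; have [_ _ f2] := c2; have [_ _ f3] := c3.
have [_ _ f4] := c4; have [_ _ f5] := c5; have [_ _ f6] := c6.
have [_ _ f7] := c7; have [_ _ f8] := c8; have [_ _ f9] := c9.
set s1 := run f P1 s; have k1 : holds s1 (rowmajor q1 h) (invmx A) by exact: H1.
(* From here on the frame property carries each matrix still needed across the stages that do not
   produce it. *)
have {}hB : holds s1 v12 B := holds_frame f f1 hv12 hB.
have {}hC : holds s1 v21 CC := holds_frame f f1 hv21 hC.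
have {}hD : holds s1 v22 D := holds_frame f f1 hv22 hD.
set s2 := run f P2 s1; have k2 : holds s2 (rowmajor q2 h) _ := H2 f s1 _ _ k1 hB.
have {}k1 : holds s2 (rowmajor q1 h) (invmx A) := holds_frame f f2 u1 k1.
have {}hC : holds s2 v21 CC by refine (holds_frame f f2 (under_leq _ hv21) hC); lia.
have {}hD : holds s2 v22 D by refine (holds_frame f f2 (under_leq _ hv22) hD); lia.
set s3 := run f P3 s2; have k3 : holds s3 (rowmajor q3 h) _ := H3 f s2 _ _ hC k1.
have {}k1 : holds s3 (rowmajor q1 h) (invmx A).
  by refine (holds_frame f f3 (under_leq _ u1) k1); lia.
have {}k2 : holds s3 (rowmajor q2 h) (invmx A *m B) :=
  holds_frame f f3 u2 k2.
have {}hC : holds s3 v21 CC by refine (holds_frame f f3 (under_leq _ hv21) hC); lia.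
have {}hD : holds s3 v22 D by refine (holds_frame f f3 (under_leq _ hv22) hD); lia.
set s4 := run f P4 s3; have k4 : holds s4 (rowmajor q4 h) _ := H4 f s3 _ _ hC k2.
have {}k1 : holds s4 (rowmajor q1 h) (invmx A).
  by refine (holds_frame f f4 (under_leq _ u1) k1); lia.
have {}k2 : holds s4 (rowmajor q2 h) (invmx A *m B) :=
  holds_frame f f4 (under_leq ll3 u2) k2.
have {}k3 : holds s4 (rowmajor q3 h) (CC *m invmx A) :=
  holds_frame f f4 u3 k3.
have {}hD : holds s4 v22 D by refine (holds_frame f f4 (under_leq _ hv22) hD); lia.
set s5 := run f P5 s4; have k5 : holds s5 (rowmajor l4 h) S.
  move=> i j; rewrite /s5 run_tabmx //=.
    by rewrite hD k4 /S !mxE.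
  move=> i1 j1 i1h j1h; apply/andP; split; last exact: u4.
  by apply: leq_trans (hv22 _ _ i1h j1h) _; lia.
have {}k1 : holds s5 (rowmajor q1 h) (invmx A).
  by refine (holds_frame f f5 (under_leq _ u1) k1); lia.
have {}k2 : holds s5 (rowmajor q2 h) (invmx A *m B) :=
  holds_frame f f5 (under_leq (leq_trans ll3 ll4) u2) k2.
have {}k3 : holds s5 (rowmajor q3 h) (CC *m invmx A) :=
  holds_frame f f5 (under_leq ll4 u3) k3.
set s6 := run f P6 s5; have k6 : holds s6 (rowmajor q6 h) _ := H6 f s5 _ pdS k5.
have {}k1 : holds s6 (rowmajor q1 h) (invmx A).
  by refine (holds_frame f f6 (under_leq _ u1) k1); lia.
have {}k2 : holds s6 (rowmajor q2 h) (invmx A *m B).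
  by refine (holds_frame f f6 (under_leq _ u2) k2); lia.
have {}k3 : holds s6 (rowmajor q3 h) (CC *m invmx A).
  by refine (holds_frame f f6 (under_leq _ u3) k3); lia.
set s7 := run f P7 s6; have k7 : holds s7 (rowmajor q7 h) _ := H7 f s6 _ _ k2 k6.
have {}k1 : holds s7 (rowmajor q1 h) (invmx A).
  by refine (holds_frame f f7 (under_leq _ u1) k1); lia.
have {}k3 : holds s7 (rowmajor q3 h) (CC *m invmx A).
  by refine (holds_frame f f7 (under_leq _ u3) k3); lia.
have {}k6 : holds s7 (rowmajor q6 h) (invmx S) :=
  holds_frame f f7 u6 k6.
set s8 := run f P8 s7; have k8 : holds s8 (rowmajor q8 h) _ := H8 f s7 _ _ k6 k3.
have {}k1 : holds s8 (rowmajor q1 h) (invmx A).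
  by refine (holds_frame f f8 (under_leq _ u1) k1); lia.
have {}k3 : holds s8 (rowmajor q3 h) (CC *m invmx A).
  by refine (holds_frame f f8 (under_leq _ u3) k3); lia.
have {}k6 : holds s8 (rowmajor q6 h) (invmx S) :=
  holds_frame f f8 (under_leq ll7 u6) k6.
have {}k7 : holds s8 (rowmajor q7 h) (invmx A *m B *m invmx S) :=
  holds_frame f f8 u7 k7.
set s9 := run f P9 s8; have k9 : holds s9 (rowmajor q9 h) _ := H9 f s8 _ _ k7 k3.
have {}k1 : holds s9 (rowmajor q1 h) (invmx A).
  by refine (holds_frame f f9 (under_leq _ u1) k1); lia.
have {}k6 : holds s9 (rowmajor q6 h) (invmx S) :=
  holds_frame f f9 (under_leq (leq_trans ll7 ll8) u6) k6.
have {}k7 : holds s9 (rowmajor q7 h) (invmx A *m B *m invmx S) :=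
  holds_frame f f9 (under_leq ll8 u7) k7.
have {}k8 : holds s9 (rowmajor q8 h) (invmx S *m (CC *m invmx A)) :=
  holds_frame f f9 u8 k8.
move=> i j; rewrite run_tabmx //; last first.
  have w1 : under h h l9 (rowmajor q1 h) by apply: under_leq u1; lia.
  have w6 : under h h l9 (rowmajor q6 h) by apply: under_leq u6; lia.
  have w7 : under h h l9 (rowmajor q7 h) by apply: under_leq u7; lia.
  have w8 : under h h l9 (rowmajor q8 h) by apply: under_leq u8; lia.
  move=> i1 j1 i1h j1h; rewrite /e10; case: ltnP => ih; case: ltnP => jh /=.
  - by rewrite w1 ?u9.
  - by rewrite w7 //; lia.
  - by rewrite w8 //; lia.
  - by rewrite w6 //; lia.
rewrite /e10; case: (split_ordP i) => i' ->; case: (split_ordP j) => j' -> /=.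
- by rewrite k1 k9 block_mxEul [RHS]mxE.
- by rewrite addKn k7 block_mxEur [RHS]mxE sub0r.
- by rewrite addKn k8 block_mxEdl [RHS]mxE sub0r.
- by rewrite !addKn k6 block_mxEdr.
Qed.

(** The sum is accumulated term by term from a matrix J of literals. The transposed factor is the
    same memory read with swapped indices; each term costs one product and one addition, [5 + 5]
    units. *)
Lemma gram_code p l Q (J : nat -> nat -> R) (V : nat -> nat -> nat -> nat) :
  (0 < p)%N -> (forall j, (j < Q)%N -> under p p l (V j)) ->
  exists P o, [/\ (l <= o)%N,
      code n l P ((1 + 10 * Q%:R) * (C * pw p)) &
    forall (f : 'cV[R]_n -> R) s (M : nat -> 'M[R]_p),
      (forall j, (j < Q)%N -> holds s (V j) (M j)) ->
      holds (run f P s) (rowmajor o p)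
        ((\matrix_(i, j) J i j) + \sum_(j < Q) M j *m (M j)^T)].
Proof.
move=> p0; have hp := sqr_le_pw p0.
elim: Q => [|Q IH] hV.
  exists (tabmx l p p (fun i j => Lit (J i j))), l; split=> //.
    apply: code_le (tabmx_code _ _ (K := 1) _) _ => //.
    by rewrite muln1 mulr0 addr0 mul1r.
  by move=> f s M _ i j; rewrite run_tabmx //= big_ord0 addr0 mxE.
have [|P1 [q1 [lq1 c1 H1]]] := IH _; first by move=> j jQ; apply: hV; apply: ltnW.
pose l1 := (q1 + p * p)%N; have ll1 : (l <= l1)%N by lia.
have u1 := under_rowmajor (leqnn l1).
have hVQ := under_leq ll1 (hV Q (ltnSn Q)).
have hVQT : under p p l1 (fun i j => V Q j i) by move=> i j ip jp; apply: hVQ.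
have [P2 [q2 [lq2 c2 H2]]] := mul_code p0 hVQ hVQT.
pose l2 := (q2 + p * p)%N; have ll2 : (l1 <= l2)%N by lia.
have u2 := under_rowmajor (leqnn l2).
pose e3 i j := Bin OpAdd (Cell R (rowmajor q1 p i j)) (Cell R (rowmajor q2 p i j)).
have c3 : code n l2 (tabmx l2 p p e3) (p * p * 5)%:R by exact: tabmx_code.
exists (Seq P1 (Seq P2 (tabmx l2 p p e3))), l2; split; first by lia.
  apply: code_le (code_seq c1 (code_seq c2 c3 ll2) ll1) _.
  rewrite natrM -[Q.+1]addn1 natrD; move: hp; set z := C * _ => hp.
  rewrite -mulrA -/z; lra.
move=> f s M hM i j; rewrite /= run_tabmx //=; last first.
  move=> i1 j1 i1p j1p; apply/andP; split; last exact: u2.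
  exact: leq_trans (u1 _ _ i1p j1p) ll2.
have [_ _ f1] := c1; have [_ _ f2] := c2.
set s1 := run f P1 s.
have k1 : holds s1 (V Q) (M Q) := holds_frame f f1 (hV Q (ltnSn Q)) (hM Q (ltnSn Q)).
have k1T : holds s1 (fun i j => V Q j i) (M Q)^T by move=> i' j'; rewrite mxE k1.
have k2 : holds s1 (rowmajor q1 p)
    ((\matrix_(i, j) J i j) + \sum_(j < Q) M j *m (M j)^T).
  by apply: H1 => j' j'Q; apply: hM; apply: ltnW.
rewrite (H2 f s1 _ _ k1 k1T) f2 ?k2; last exact: u1.
by rewrite big_ord_recr /= addrA [RHS]mxE.
Qed.

(** * One iteration as a program *)

Variable m : nat.
Hypotheses (m_gt0 : (0 < m)%N) (le_mn : (m <= n)%N).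

Let xs : nat := m * n + m.
Let ps : nat := xs + n.

Let work : R := n%:R * m%:R `^ (omega - 1).

Lemma exists_dsz : exists2 k, (m <= dsz k)%N & (dsz k <= 2 * m)%N.
Proof.
case: (posnP m.-1) => [m1|m1]; first by exists 0%N; rewrite /=; lia.
have m2 : (1 < m)%N by lia.
have /andP[h1 h2] := up_log_bounds (ltnSn 1) m2; exists (up_log 2 m); rewrite dszE //.
have -> : up_log 2 m = (up_log 2 m).-1.+1 by rewrite prednK // up_log_gt0.
by rewrite expnS leq_mul2l /= ltnW.
Qed.

Lemma mul_le_work : (n * m)%:R <= C * work.
Proof.
have m0 : 0 < m%:R :> R by rewrite ltr0n.
have := sqr_le_pw m_gt0; have om := omega_ge2.
rewrite /pw -(mulr_powRB1 (ltW m0)); last by lra.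
rewrite natrM mulrCA ler_pM2l // natrM /work => h.
by rewrite mulrCA ler_wpM2l.
Qed.

(** Splits [c p^omega] as [(c p) p^(omega - 1)] and bounds the factors by [3 n] and
    [(2 m)^(omega - 1)]. It serves both for the Q block products and for the single inversion. *)
Lemma pw_le_work p (c : nat) : (0 < p)%N -> (p <= 2 * m)%N -> (c * p <= 3 * n)%N ->
  c%:R * pw p <= 3 * 2 `^ (omega - 1) * work.
Proof.
move=> p_gt0 pm cp; have om := omega_ge2.
rewrite /pw -(mulr_powRB1 (ler0n _ p)); last by lra.
rewrite mulrA -natrM.
have -> : 3 * 2 `^ (omega - 1) * work = (3 * n)%:R * (2 * m)%:R `^ (omega - 1).
  by rewrite /work !natrM powRM // !mulrA; congr (_ * _); rewrite mulrAC.
apply: ler_pM; rewrite ?powR_ge0 ?ler_nat //.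
by apply: ge0_ler_powR; rewrite ?nnegrE ?ler_nat //; lra.
Qed.

(* The cell ps.+2 holds the iteration limit, and ps.+3 counts the iterations. *)
Definition state_at s (A : 'M[R]_(m, n)) x (eps beta : R) (t : nat) :=
  [/\ holds s (rowmajor 0 n) A, forall i : 'I_n, s (xs + i)%N = x i (0 : 'I_1),
      s ps = eps, s ps.+1 = beta & s ps.+3 = t%:R].

Lemma direction_code :
  exists P o, [/\ (ps + 4 <= o)%N,
    code n (ps + 4) P ((120 + 135 * 2 `^ (omega - 1)) * C * work) &
    forall f s (A : 'M[R]_(m, n)) (x : 'cV[R]_n) eps beta N,
      row_free A -> positive x -> (forall x, positive x -> differentiable f x) ->
      state_at s A x eps beta N ->
      exists (r : 'cV[R]_n) (lambda : 'cV[R]_m),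
      [/\ r = diag x *m grad (phi f eps) x - (A *m diag x)^T *m lambda,
          A *m diag x *m r = 0 &
          forall i : 'I_n, run f P s (o + i)%N =
            next_iterate x (- (beta / norm2 r) *: r) i 0]].
Proof.
have [k mp pm] := exists_dsz; have p_gt0 := dsz_gt0 k; set p := dsz k in mp pm p_gt0.
(* Q blocks of p columns cover all n columns, and the excess is harmless: [Q p <= n + p <= 3 n]. *)
pose Q := (n %/ p).+1.
have nQ : (n <= Q * p)%N by apply/ltnW/ltn_ceil.
have Qn : (Q * p <= 3 * n)%N.
  by have := leq_divM n p; rewrite /Q mulSn; lia.
(* Layout: the gradient of f at l0, the scaled gradient u of [phi] at l1, the padded matrix [L B] at
   l2, [L B u] at l3, the Gram matrix G at q5, its inverse at q6, w at l6, the projection r at l7,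
   [beta / norm2 r] at l8 and the next iterate at l9. *)
pose l0 := (ps + 4)%N; pose l1 := (l0 + n)%N; pose l2 := (l1 + n)%N.
pose P1 := Gradient R l0 xs.
have c1 : code n l0 P1 n%:R.
  split=> // f s a al /=; rewrite /write_vec; case: pickP => // i /eqP aE.
  by move: al; rewrite aE ltnNge leq_addr.
pose e2 i := Bin OpSub (Bin OpMul (Cell R (xs + i)) (Cell R (l0 + i))) (Cell R ps).
have c2 : code n l1 (tab l1 n e2) (n * 8)%:R by exact: tab_code.
pose e3 i t := if (i < m)%N && (t < n)%N
  then Bin OpMul (Cell R (i * n + t)) (Cell R (xs + t)) else Lit 0.
have c3 : code n l2 (tabmx l2 p (Q * p) e3) (p * (Q * p) * 5)%:R.
  by apply: tabmx_code => i t _ _; rewrite /e3; case: ifP.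
pose bv := rowmajor l2 (Q * p).
pose l3 := (l2 + p * (Q * p))%N.
have ub : under p (Q * p) l3 bv by exact: under_rowmajor.
pose e4 i := esum n (fun t => Bin OpMul (Cell R (bv i t)) (Cell R (l1 + t))).
have c4 : code n l3 (tab l3 p e4) (p * (n * 6 + 1))%:R.
  by apply: tab_code => i _; apply: esize_esum.
pose l4 := (l3 + p)%N.
(* The entries of [1 - L L^T], with ones on the diagonal of the padding rows. They depend on m only,
   so they can be literals of the program. *)
pose J (i j : nat) : R := ((i == j) && (m <= i))%N%:R.
pose V (j i c : nat) := bv i (j * p + c)%N.
have hV j : (j < Q)%N -> under p p l4 (V j).
  move=> jQ i c ip cp; apply: leq_trans (ub i (j * p + c)%N ip _) (leq_addr _ _).
  by have := rowmajor_lt 0 jQ cp; rewrite /rowmajor !add0n.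
have [P5 [q5 [lq5 c5 H5]]] := gram_code J p_gt0 hV.
pose l5 := (q5 + p * p)%N.
have [P6 [q6 [lq6 c6 H6]]] := inverse_code (under_rowmajor (leqnn l5)).
pose l6 := (q6 + p * p)%N.
rewrite -/p in c6 H6.
pose e7 i := esum p (fun j => Bin OpMul (Cell R (rowmajor q6 p i j)) (Cell R (l3 + j))).
have c7 : code n l6 (tab l6 p e7) (p * (p * 6 + 1))%:R.
  by apply: tab_code => i _; apply: esize_esum.
pose l7 := (l6 + p)%N.
pose e8 j := Bin OpSub (Cell R (l1 + j))
  (esum p (fun i => Bin OpMul (Cell R (bv i j)) (Cell R (l6 + i)))).
have c8 : code n l7 (tab l7 n e8) (n * (p * 6 + 4))%:R.
  apply: tab_code => j _ /=.
  have := esize_esum (k := p)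
    (g := fun i => Bin OpMul (Cell R (bv i j)) (Cell R (l6 + i))) (K := 5).
  by move=> /(_ (fun _ _ => isT)); lia.
pose l8 := (l7 + n)%N.
pose e9 (_ : nat) := Bin OpDiv (Cell R ps.+1)
  (SqrtE (esum n (fun j => Bin OpMul (Cell R (l7 + j)) (Cell R (l7 + j))))).
have c9 : code n l8 (tab l8 1 e9) (1 * (n * 6 + 5))%:R.
  apply: tab_code => j _ /=.
  have := esize_esum (k := n)
    (g := fun j => Bin OpMul (Cell R (l7 + j)) (Cell R (l7 + j))) (K := 5).
  by move=> /(_ (fun _ _ => isT)); lia.
pose l9 := (l8 + 1)%N.
pose e10 j := Bin OpSub (Cell R (xs + j))
  (Bin OpMul (Cell R (xs + j)) (Bin OpMul (Cell R l8) (Cell R (l7 + j)))).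
have c10 : code n l9 (tab l9 n e10) (n * 11)%:R by exact: tab_code.
have ll1 : (l0 <= l1)%N by exact: leq_addr.
have ll2 : (l1 <= l2)%N by exact: leq_addr.
have ll3 : (l2 <= l3)%N by exact: leq_addr.
have ll4 : (l3 <= l4)%N by exact: leq_addr.
have ll5 : (l4 <= l5)%N by apply: leq_trans lq5 (leq_addr _ _).
have ll6 : (l5 <= l6)%N by apply: leq_trans lq6 (leq_addr _ _).
have ll7 : (l6 <= l7)%N by exact: leq_addr.
have ll8 : (l7 <= l8)%N by exact: leq_addr.
have ll9 : (l8 <= l9)%N by exact: leq_addr.
exists (Seq P1 (Seq (tab l1 n e2) (Seq (tabmx l2 p (Q * p) e3) (Seq (tab l3 p e4)
  (Seq P5 (Seq P6 (Seq (tab l6 p e7) (Seq (tab l7 n e8) (Seq (tab l8 1 e9)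
  (tab l9 n e10)))))))))), l9.
split; first by lia.
  have := code_seq c1 (code_seq c2 (code_seq c3 (code_seq c4 (code_seq c5 (code_seq c6
    (code_seq c7 (code_seq c8 (code_seq c9 c10 ll9) ll8) ll7) ll6) ll5) ll4) ll3) ll2) ll1.
  move/code_le; apply.
  have lin : n%:R + (n * 8)%:R + (p * (Q * p) * 5)%:R + (p * (n * 6 + 1))%:R +
      (p * (p * 6 + 1))%:R + (n * (p * 6 + 4))%:R + (1 * (n * 6 + 5))%:R +
      (n * 11)%:R <= (120 * (n * m))%:R :> R.
    rewrite -!natrD ler_nat.
    have h1 := leq_mul pm Qn; have h2 := leq_mul pm (leqnn n).
    have h3 := leq_mul pm (leq_trans pm (leq_mul (leqnn 2) le_mn)).
    have h4 : (n <= n * m)%N by rewrite leq_pmulr.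
    by lia.
  (* The Gram matrix and the inversion cost [(1 + 10 Q) + 34] units of [C * pw p]. Both [pw p] and
     [Q * pw p] are at most [3 * 2^(omega - 1) * work], and [(35 + 10) * 3 = 135]. *)
  have w1 := pw_le_work (c := Q) p_gt0 pm Qn.
  have w2 : 1%:R * pw p <= _ := pw_le_work (c := 1) p_gt0 pm ltac:(lia).
  have C1 : 0 < C by have := C_ge1; lra.
  have := mul_le_work; rewrite [X in _ <= X]natrM in lin; move: lin w1 w2.
  rewrite -/p mulr1n mul1r.
  move: (pw p) (2 `^ (omega - 1)) work (Q%:R) => a b w c lin w1 w2 w3.
  have {}w1 : C * (c * a) <= C * (3 * b * w) by rewrite ler_pM2l.
  have {}w2 : C * a <= C * (3 * b * w) by rewrite ler_pM2l.
  have e1 : (1 + 10 * c) * (C * a) = C * a + 10 * (C * (c * a)) by ring.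
  have e : (120 + 135 * b) * C * w = 120 * (C * w) + 45 * (C * (3 * b * w)) by ring.
  by rewrite e e1; lra.
move=> f s A x eps beta N Afree x0 df [hA hx heps hbeta _].
have [_ _ f1] := c1; have [_ _ f2] := c2; have [_ _ f3] := c3.
have [_ _ f4] := c4; have [_ _ f5] := c5; have [_ _ f6] := c6.
have [_ _ f7] := c7; have [_ _ f8] := c8; have [_ _ f9] := c9.
pose s1 := run f P1 s.
have {}f1 a : (a < l0)%N -> s1 a = s a by exact: (f1 f s a).
set u := diag x *m grad (phi f eps) x.
pose s2 := run f (tab l1 n e2) s1.
have hu (i : 'I_n) : s2 (l1 + i)%N = u i 0.
  rewrite /s2 run_tab //=; last first.
    by move=> j jn /=; apply/andP; split; [apply/andP; split|]; lia.
  rewrite (f1 ps) ?(f1 (xs + i)%N) ?heps ?hx; try by have := ltn_ord i; lia.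
  have -> : u i 0 = x i 0 * grad f x i 0 - eps := scaled_gradE eps df i x0.
  congr (_ * _ - _).
  rewrite /s1 /= /write_vec; case: pickP => [j|/(_ i)]; last by rewrite eqxx.
  rewrite eqn_add2l => /eqP ij; rewrite (_ : j = i); last exact/val_inj.
  congr (grad f _ i 0); apply/colP => i'; rewrite mxE; exact: hx.
have g2 a : (a < l0)%N -> s2 a = s a by move=> al; rewrite /s2 f2 ?f1 //; lia.
pose L : 'M[R]_(p, m) := pid_mx m; pose B := A *m diag x.
pose s3 := run f (tabmx l2 p (Q * p) e3) s2.
have s3E i t : (i < p)%N -> (t < Q * p)%N -> s3 (bv i t) = eval s2 (e3 i t).
  move=> ip tq; rewrite /s3 run_tabmx // => i1 t1 i1p t1q; rewrite /e3.
  case: ifP => // /andP[i1m t1n] /=.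
  by have := rowmajor_lt 0 i1m t1n; rewrite /rowmajor !add0n => h; lia.
have hB0 (i : 'I_p) t : (n <= t)%N -> (t < Q * p)%N -> s3 (bv i t) = 0.
  by move=> nt tq; rewrite s3E // /e3 [(t < n)%N]ltnNge nt andbF.
have hB (i : 'I_p) (t : 'I_n) : s3 (bv i t) = (L *m B) i t.
  rewrite s3E //; last exact: leq_trans nQ.
  rewrite mul_pid_mx_rowE /e3 ltn_ord andbT; case: insubP => [i' im iE|/negPf->] //=.
  have := rowmajor_lt 0 im (ltn_ord t); rewrite /rowmajor !add0n => h.
  rewrite im /= !g2; try by have := ltn_ord t; lia.
  by rewrite hx -iE (hA i' t) /B mul_mx_diag !mxE.
have hu3 (i : 'I_n) : s3 (l1 + i)%N = u i 0.
  by rewrite /s3 f3 ?hu //; have := ltn_ord i; lia.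
have g3 a : (a < l0)%N -> s3 a = s a by move=> al; rewrite /s3 f3 ?g2 //; lia.
pose s4 := run f (tab l3 p e4) s3.
have ubn i j : (i < p)%N -> (j < n)%N -> (bv i j < l3)%N.
  by move=> ip jn; apply: ub => //; apply: leq_trans nQ.
have hh (i : 'I_p) : s4 (l3 + i)%N = (L *m B *m u) i 0.
  rewrite /s4 run_tab //; last first.
    move=> j jp; apply: below_esum => t tn /=; apply/andP; split; first exact: ubn.
    by lia.
  by rewrite eval_esum mxE; apply: eq_bigr => t _; rewrite /= hB hu3.
pose M j : 'M[R]_p := \matrix_(i, c) s3 (V j i c).
have hM j : (j < Q)%N -> holds s4 (V j) (M j).
  move=> jQ i c; rewrite mxE /s4 f4 // /V; apply: ub => //.
  by have := rowmajor_lt 0 jQ (ltn_ord c); rewrite /rowmajor !add0n.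
pose s5 := run f P5 s4.
pose G := 1%:M - L *m L^T + L *m B *m (L *m B)^T.
have hG : holds s5 (rowmajor q5 p) G.
  rewrite (_ : G = (\matrix_(i, j) J i j) + \sum_(j < Q) M j *m (M j)^T).
    exact: (H5 f s4 M hM).
  rewrite /G; congr (_ + _).
    apply/matrixP => i j; rewrite tr_pid_mx mul_pid_mx !minnn !mxE /J.
    rewrite -[i == j]/(nat_of_ord i == nat_of_ord j).
    case: (nat_of_ord i == nat_of_ord j); rewrite /= ?subrr // [(m <= _)%N]leqNgt.
    by case: (_ < m)%N; rewrite ?subrr ?subr0.
  apply/matrixP => i j; rewrite summxE.
  rewrite (eq_bigr (fun a : 'I_Q => \sum_(c < p)
      s3 (bv i (a * p + c)%N) * s3 (bv j (a * p + c)%N))); last first.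
    by move=> a _; rewrite mxE; apply: eq_bigr => c _; rewrite !mxE.
  (* The columns from n on are zero, so the sum over [Q * p] columns reduces to the n genuine
     ones. *)
  rewrite (sum_blocks (fun t => s3 (bv i t) * s3 (bv j t))).
  rewrite -(big_mkord xpredT (fun t => s3 (bv i t) * s3 (bv j t))).
  rewrite (@big_cat_nat _ _ _ n) //= [X in _ + X]big1_seq ?addr0; last first.
    by move=> t /andP[_]; rewrite mem_index_iota => /andP[nt tq]; rewrite hB0 ?mul0r.
  rewrite big_mkord mxE; apply: eq_bigr => t _; rewrite !hB.
  by rewrite [(L *m B)^T _ _]mxE.
have Lis : L^T *m L = 1%:M by exact: pid_mx_isometry.
have Bfree : row_free B by exact: row_free_scaled.
pose s6 := run f P6 s5.
have hinv : holds s6 (rowmajor q6 p) (invmx G).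
  exact: H6 (posdef_padded_gram Lis Bfree) hG.
have hh6 (i : 'I_p) : s6 (l3 + i)%N = (L *m B *m u) i 0.
  by rewrite /s6 /s5 f6 ?f5 ?hh //; have := ltn_ord i; lia.
pose s7 := run f (tab l6 p e7) s6.
pose w := invmx G *m (L *m B *m u).
have hw (i : 'I_p) : s7 (l6 + i)%N = w i 0.
  rewrite /s7 run_tab //; last first.
    move=> i1 i1p; apply: below_esum => j jp /=; apply/andP; split; last by lia.
    exact: under_rowmajor (leqnn l6) _ _ i1p jp.
  by rewrite eval_esum mxE; apply: eq_bigr => j _; rewrite /= hinv hh6.
have g7 a : (a < l3)%N -> s7 a = s3 a.
  by move=> al; rewrite /s7 /s6 /s5 /s4 f7 ?f6 ?f5 ?f4 //; lia.
pose s8 := run f (tab l7 n e8) s7.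
pose r := u - (L *m B)^T *m w.
have hr (j : 'I_n) : s8 (l7 + j)%N = r j 0.
  rewrite /s8 run_tab //; last first.
    move=> j1 j1n /=; apply/andP; split; first by lia.
    apply: below_esum => i ip /=; apply/andP; split; last by lia.
    by have := ubn i j1 ip j1n; lia.
  rewrite /= eval_esum g7 ?hu3; last by have := ltn_ord j; lia.
  rewrite /r [RHS]mxE [X in _ = _ + X]mxE [X in _ = _ - X]mxE; congr (_ - _).
  apply: eq_bigr => i _; rewrite /= hw g7; last exact: ubn.
  by rewrite hB [(L *m B)^T _ _]mxE.
have g8 a : (a < l0)%N -> s8 a = s a.
  by move=> al; rewrite /s8 f8 ?g7 ?g3 //; lia.
(* The multiplier of the original constraints, as [(L B)^T w = B^T (L^T w)]. *)
exists r, (L^T *m w); split.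
- by rewrite /r trmx_mul mulmxA.
- exact: padded_projection.
pose s9 := run f (tab l8 1 e9) s8.
have hc : s9 l8 = beta / norm2 r.
  rewrite /s9 -[X in _ X = _]addn0 run_tab //; last first.
    move=> _ _ /=; apply/andP; split; first by lia.
    by apply: below_esum => j jn /=; apply/andP; split; lia.
  rewrite /= eval_esum g8 ?hbeta; last by lia.
  congr (_ / Num.sqrt _); apply: eq_bigr => j _; by rewrite /= hr.
have g9 a : (a < l8)%N -> s9 a = s8 a by move=> al; rewrite /s9 f9.
move=> i; rewrite -[run f _ s]/(run f (tab l9 n e10) s9); clearbody s9.
rewrite run_tab //=; last first.
  by move=> j jn; apply/andP; split; [|apply/andP; split; [|apply/andP; split]]; lia.
rewrite hc !g9; try by have := ltn_ord i; lia.
rewrite hr g8; last by have := ltn_ord i; lia.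
by rewrite hx next_iterate_coord !mxE; ring.
Qed.

Definition iteration_cost := (168 + 135 * 2 `^ (omega - 1)) * C * work.

(* A successful stopping test resets the iteration limit to 0, which ends the
   loop. *)
Lemma iteration_code : exists P : program R,
  forall f s (A : 'M[R]_(m, n)) (x : 'cV[R]_n) eps beta N,
    0 < beta < 1 -> row_free A -> positive x ->
    (forall x, positive x -> differentiable f x) ->
    state_at s A x eps beta N ->
    exists s' k d, [/\ exec f P s s' k, k%:R <= iteration_cost,
      trust_region_solution A f eps beta x d &
      if `[< stopping_test f eps beta x d >]
      then state_at s' A x eps beta N.+1 /\ s' ps.+2 = 0
      else state_at s' A (next_iterate x d) eps beta N.+1 /\ s' ps.+2 = s ps.+2].
Proof.
have [D [q [po cD HD]]] := direction_code.
pose l1 := (q + n)%N; pose l2 := l1.+2.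
pose phi_expr (v src : nat) := Bin OpSub (Cell R v)
  (Bin OpMul (Cell R ps) (esum n (fun i => LnE (Cell R (src + i))))).
(* The change of [phi] goes to l2, the negated threshold to the next cell, and a literal 1 for
   incrementing the counter to the one after. *)
pose e2 := Bin OpSub (phi_expr l1.+1 q) (phi_expr l1 xs).
pose e3 := Bin OpSub (Lit 0) (Bin OpMul (Bin OpMul (Cell R ps) (Cell R ps.+1))
  (Bin OpSub (Lit 1) (Cell R ps.+1))).
pose S := Seq D (Seq (Value R l1 xs) (Seq (Value R l1.+1 q)
  (Seq (compile e2 l2) (Seq (compile e3 l2.+1) (compile (Lit 1) l2.+2))))).
have se2 : (esize e2 <= 8 * n + 19)%N.
  have h src : (esize (esum n (fun i => LnE (Cell R (src + i)))) <= n * 4 + 1)%N.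
    exact: esize_esum.
  by have := h q; have := h xs; rewrite /=; lia.
have cS : code n (ps + 4) S ((120 + 135 * 2 `^ (omega - 1)) * C * work +
    (n%:R + (n%:R + ((esize e2)%:R + (12%:R + 1%:R))))).
  apply: code_seq cD _ (leqnn _); rewrite -/(code _ _ _ _).
  have pl1 : (ps + 4 <= l1)%N by exact: leq_trans po (leq_addr _ _).
  have [s1 k1 f1] := code_seq (value_code R n l1 xs) (code_seq (value_code R n l1.+1 q)
    (code_seq (compile_code n l2 e2) (code_seq (compile_code n l2.+1 e3)
      (compile_code n l2.+2 (Lit 1)) (leqnSn _)) (leqnSn _)) (leqnSn _)) (leqnSn _).
  by split=> // f s a al; apply: f1; apply: leq_trans pl1.
(* The comparison holds exactly when the stopping test fails; only then does the new iterate at q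
   replace the old one. *)
pose P := Seq (Seq S (Instr (Add R ps.+3 ps.+3 l2.+2)))
  (IfLe l2 l2.+1 (copy R xs q n) (Instr (Const ps.+2 0))).
exists P => f s A x eps beta N beta01 Afree x0 df st.
have [r [lambda [rE Br0 hD]]] := HD f s A x eps beta N Afree x0 df st.
have [hA hx heps hbeta hN] := st.
set d := - (beta / norm2 r) *: r in hD.
have [hd _] := projected_gradient_step beta01 rE Br0; rewrite -/d in hd.
have [sS kS fS] := cS.
pose s1 := run f S s.
have s1E a : (a < ps + 4)%N -> s1 a = s a by exact: (fS f s).
have [_ _ fD] := cD.
pose sD := run f D s; rewrite -/sD in hD.
have gD a : (a < ps + 4)%N -> sD a = s a by exact: (fD f s).
have rx : read_vec n sD xs = x.
  by apply: read_vec_eq => i; rewrite gD ?hx //; have := ltn_ord i; lia.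
pose sV := store sD l1 (f x).
have rx' : read_vec n sV q = next_iterate x d.
  apply: read_vec_eq => i; rewrite /sV storeE ltn_eqF ?hD //.
  by rewrite ltn_add2l.
pose sW := store sV l1.+1 (f (next_iterate x d)).
have sVE : run f (Value R l1 xs) sD = sV by rewrite [LHS]/= rx.
have sWE : run f (Value R l1.+1 q) sV = sW by rewrite [LHS]/= rx'.
have s1S : s1 = run f (compile (Lit 1) l2.+2)
    (run f (compile e3 l2.+1) (run f (compile e2 l2) sW)).
  by rewrite -sWE -sVE.
have s1run : run f S s = s1 := erefl.
clearbody s1.
have gW a : (a < l1)%N -> sW a = sD a.
  by move=> al; rewrite /sW /sV !storeE !ltn_eqF //; lia.
have sW0 : sW l1 = f x by rewrite /sW storeE ltn_eqF // /sV storeE eqxx.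
have sW1 : sW l1.+1 = f (next_iterate x d) by rewrite /sW storeE eqxx.
clearbody sW.
have phiE1 : eval sW (phi_expr l1 xs) = phi f eps x.
  rewrite /= eval_esum sW0 gW ?gD ?heps; try lia.
  congr (_ - _ * _).
  apply: eq_bigr => i _ /=; have hi := ltn_ord i.
  by rewrite gW ?gD ?hx //; lia.
have phiE2 : eval sW (phi_expr l1.+1 q) = phi f eps (next_iterate x d).
  rewrite /= eval_esum sW1 gW ?gD ?heps; try lia.
  congr (_ - _ * _).
  apply: eq_bigr => i _ /=; have hi := ltn_ord i.
  by rewrite gW ?hD //; lia.
have s1l2 : s1 l2 = phi f eps (next_iterate x d) - phi f eps x.
  rewrite s1S (frame_compile (Lit 1)) ?(frame_compile e3) // run_compile.
    by rewrite -phiE1 -phiE2.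
  rewrite /= !below_esum //; try (by move=> i im /=; lia).
  by rewrite !andbT; do ?[apply/andP; split]; lia.
have s1l3 : s1 l2.+1 = - (eps * beta * (1 - beta)).
  rewrite s1S frame_compile // run_compile; last by rewrite /=; lia.
  rewrite -[eval _ _]/(0 - run f (compile e2 l2) sW ps *
    run f (compile e2 l2) sW ps.+1 * (1 - run f (compile e2 l2) sW ps.+1)).
  by rewrite !frame_compile ?gW ?gD ?heps ?hbeta ?sub0r //; lia.
have s1l4 : s1 l2.+2 = 1 by rewrite s1S run_compile.
pose s2 := store s1 ps.+3 (s1 ps.+3 + s1 l2.+2).
have s2E a : (a < ps + 4)%N -> a != ps.+3 -> s2 a = s a.
  by move=> al /negPf ne; rewrite /s2 storeE ne s1E.
have s2N : s2 ps.+3 = N.+1%:R.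
  by rewrite /s2 storeE eqxx s1l4 s1E ?hN ?natr1 //; lia.
have s2F a : (ps + 4 <= a)%N -> s2 a = s1 a.
  by move=> al; rewrite /s2 storeE gtn_eqF //; lia.
have ex1 : exec f (Seq S (Instr (Add R ps.+3 ps.+3 l2.+2))) s s2 (cost n S + 1)%N.
  have h := exec_straight f s sS; rewrite s1run in h.
  exact: ExecSeq h (ExecInstr f (Add R ps.+3 ps.+3 l2.+2) s1).
have st2 : state_at s2 A x eps beta N.+1.
  split=> [i j|i|||]; rewrite -/xs -/ps //.
  - have := rowmajor_lt 0 (ltn_ord i) (ltn_ord j); rewrite add0n => h.
    by rewrite s2E ?hA //; lia.
  - by have hi := ltn_ord i; rewrite s2E ?hx //; lia.
  - by rewrite s2E //; lia.
  - by rewrite s2E //; lia.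
(* Everything besides the direction costs at most [12 n + 36 <= 48 n m], whence [168 = 120 + 48] in
   [iteration_cost]. *)
have kbound (c : nat) : (c <= 2 * n + 2)%N -> (cost n S + 1 + c.+1)%:R <= iteration_cost.
  move=> hc; rewrite natrD [(cost n S + 1)%:R]natrD.
  have lin : n%:R + (n%:R + ((esize e2)%:R + (12%:R + 1%:R))) + 1%:R + c.+1%:R
      <= (48 * (n * m))%:R :> R.
    by rewrite -!natrD ler_nat; nia.
  have := mul_le_work; rewrite [X in _ <= X]natrM in lin.
  rewrite -/work /iteration_cost.
  have -> : (168 + 135 * 2 `^ (omega - 1)) * C * work =
    (120 + 135 * 2 `^ (omega - 1)) * C * work + 48 * (C * work) by ring.
  by move: lin kS; lra.
have [stop|nstop] := asboolP (stopping_test f eps beta x d).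
  exists (store s2 ps.+2 0), (cost n S + 1 + 2)%N, d; split=> //.
  - apply: ExecSeq ex1 _; apply: ExecIfFalse (ExecInstr _ _ _).
    by rewrite !s2F ?s1l2 ?s1l3 //; lia.
  - by apply: (kbound 1%N); lia.
  rewrite asboolT //; split; last by rewrite storeE eqxx.
  have [h1 h2 h3 h4 h5] := st2; rewrite -/xs -/ps in h2 h3 h4 h5.
  split=> [i j|i|||]; rewrite -/xs -/ps storeE.
  - have := rowmajor_lt 0 (ltn_ord i) (ltn_ord j); rewrite add0n => h.
    by rewrite ltn_eqF ?h1 //; lia.
  - by have hi := ltn_ord i; rewrite ltn_eqF ?h2 //; lia.
  - by rewrite ltn_eqF ?h3.
  - by rewrite ltn_eqF ?h4.
  - by rewrite gtn_eqF ?h5.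
have qx : (xs + n <= q)%N by lia.
exists (run f (copy R xs q n) s2), (cost n S + 1 + (n * 2).+1)%N, d; split=> //.
- apply: ExecSeq ex1 _; rewrite -(cost_copy R n xs q n).
  apply: ExecIfTrue (exec_straight f s2 (straight_copy R xs q n)).
  by rewrite !s2F ?s1l2 ?s1l3; try lia; rewrite leNgt; apply/negP.
- by apply: kbound; lia.
rewrite asboolF //; have [h1 h2 h3 h4 h5] := st2.
rewrite -/xs -/ps in h2 h3 h4 h5.
have outside a : ~~ (xs <= a < xs + n)%N -> run f (copy R xs q n) s2 a = s2 a.
  by move=> /negPf ha; rewrite run_copy // ha.
split; last by rewrite outside ?s2E //; lia.
split=> [i j|i|||]; rewrite -/xs -/ps.
- have := rowmajor_lt 0 (ltn_ord i) (ltn_ord j); rewrite add0n => h.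
  by rewrite outside ?h1 //; lia.
- have hi := ltn_ord i.
  rewrite run_copy // (_ : (xs <= xs + i < xs + n)%N = true); last by lia.
  rewrite addKn s2F; last by lia.
  rewrite s1S !frame_compile; try lia.
  by rewrite gW ?hD //; lia.
- by rewrite outside ?h3 //; lia.
- by rewrite outside ?h4 //; lia.
- by rewrite outside ?h5 //; lia.
Qed.

End FastArithmetic.

(** * The main loop *)

Section Execution.
Variables (R : realType) (m n : nat) (P : program R) (c : R).
Variables (A : 'M[R]_(m, n)) (b : 'cV[R]_m) (f : 'cV[R]_n -> R) (eps beta T : R).

Let ps : nat := m * n + m + n.

Hypothesis beta01 : 0 < beta < 1.
Hypothesis P_iteration : forall s x N, positive x -> state_at s A x eps beta N ->
  exists s' k d, [/\ exec f P s s' k, k%:R <= c,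
    trust_region_solution A f eps beta x d &
    if `[< stopping_test f eps beta x d >]
    then state_at s' A x eps beta N.+1 /\ s' ps.+2 = 0
    else state_at s' A (next_iterate x d) eps beta N.+1 /\ s' ps.+2 = s ps.+2].

(** Induction on an integer bound r for the remaining iterations, building the machine run and the
    derivation of [returns] together. The limit T of [returns] stays fixed even when a successful
    test zeroes its cell. *)
Lemma exec_loop r s x N : T <= (N + r)%:R -> interior_feasible A b x ->
  state_at s A x eps beta N -> s ps.+2 = T ->
  exists s' k M y, [/\ exec f (WhileLt ps.+3 ps.+2 P) s s' k,
    returns A f eps beta T N x M y, state_at s' A y eps beta M &
    k%:R <= r%:R * (c + 2) + 1].
Proof.
have counter s' x' N' : state_at s' A x' eps beta N' -> s' ps.+3 = N'%:R by case.
elim: r s x N => [|r IH] s x N Tr ix st sT; have [TN|NT] := leP T N%:R.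
- exists s, 1%N, N, x; split=> //; last by rewrite mul0r add0r.
    by apply: ExecWhileEnd; rewrite (counter _ _ _ st) sT.
  exact: ReturnsLimit.
- by move: NT; rewrite ltNge -[N]addn0 Tr.
(* The iteration is invoked here only to learn [0 <= c], as c bounds a natural number. *)
- have [s1 [k1 [d [_ k1c _ _]]]] := P_iteration ix.2 st.
  have c0 : 0 <= c by apply: le_trans k1c.
  exists s, 1%N, N, x; split=> //.
  + by apply: ExecWhileEnd; rewrite (counter _ _ _ st) sT.
  + exact: ReturnsLimit.
  + by rewrite lerDr mulr_ge0 // addr_ge0.
have [s1 [k1 [d [ex1 k1c dsol]]]] := P_iteration ix.2 st.
have c0 : 0 <= c by apply: le_trans k1c.
have lt1 : s ps.+3 < s ps.+2 by rewrite (counter _ _ _ st) sT.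
have [stop [st1 sT1]|nstop [st1 sT1]] := asboolP (stopping_test f eps beta x d).
  exists s1, (k1 + 1).+1, N.+1, x; split=> //.
  - apply: ExecWhileLoop lt1 ex1 _.
    by apply: ExecWhileEnd; rewrite (counter _ _ _ st1) sT1.
  - exact: ReturnsStop dsol stop.
  - rewrite addn1 -addn2 natrD -[r.+1]addn1 natrD mulrDl mul1r.
    have : 0 <= r%:R * (c + 2) by rewrite mulr_ge0 // addr_ge0.
    by lra.
have [|||s2 [k2 [M [y [ex2 ret2 st2 k2c]]]]] := IH s1 _ N.+1 _ _ st1.
- by rewrite addSnnS.
- by case: dsol => hd _; apply: next_iterate_interior ix hd.
- by rewrite sT1.
exists s2, (k1 + k2).+1, M, y; split=> //.
- exact: ExecWhileLoop lt1 ex1 ex2.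
- exact: ReturnsStep dsol nstop ret2.
- by rewrite -natr1 natrD -[r.+1]addn1 natrD; lra.
Qed.

End Execution.

Lemma input_state (R : realType) m n s (A : 'M[R]_(m, n)) b x eps beta T :
  let s0 := store s (m * n + m + n).+3 0 in
  input_at s A b x eps beta T ->
  state_at s0 A x eps beta 0 /\ s0 (m * n + m + n).+2 = T.
Proof.
move=> s0 [hA _ hx [heps hb hT]].
have s0E a : (a < (m * n + m + n).+3)%N -> s0 a = s a.
  by move=> al; rewrite /s0 storeE ltn_eqF.
split; last by rewrite s0E.
split=> [i j|i|||]; last by rewrite /s0 storeE eqxx.
- have := rowmajor_lt 0 (ltn_ord i) (ltn_ord j); rewrite add0n => h.
  by rewrite s0E ?hA //; lia.
- have hi := ltn_ord i; rewrite s0E; last by lia.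
  by have := hx i 0; rewrite muln1 addn0.
- by rewrite s0E ?heps //; lia.
- by rewrite s0E ?hb //; lia.
Qed.

(** The iterate is moved to the front and the counter right behind it. As [m > 0], the source lies
    above the n target cells, as [run_copy] requires. *)
Lemma output_state (R : realType) m n (f : 'cV[R]_n -> R) s (A : 'M[R]_(m, n))
    (x : 'cV[R]_n) eps beta N : (0 < m)%N -> state_at s A x eps beta N ->
  let s' := run f (copy R n (m * n + m + n).+3 1)
    (run f (copy R 0 (m * n + m) n) s) in
  mx_at s' 0 x /\ s' n = N%:R.
Proof.
move=> m_gt0 [_ h2 _ _ h5]; have mn : (n <= m * n)%N by rewrite leq_pmull.
split=> [i j|].
  have hi := ltn_ord i; rewrite !ord1 muln1 addn0 add0n.
  rewrite run_copy; last by lia.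
  rewrite ifF; last by lia.
  rewrite run_copy; last by lia.
  by rewrite ifT ?subn0 ?h2.
rewrite run_copy; last by lia.
rewrite ifT; last by lia.
rewrite subnn addn0 run_copy; last by lia.
by rewrite ifF ?h5 //; lia.
Qed.

(** * Uniform constants and the complexity bound *)

Lemma total_cost_le (R : realType) (C kappa D eps work n k r : R) :
  1 <= C -> 0 <= kappa -> 0 <= D -> 0 < eps -> eps <= 1 -> 1 <= n ->
  n <= C * work -> 0 <= work -> 0 <= r -> r <= (D + 1) / eps ->
  k <= r * (kappa * work + 2) + 1 ->
  1 + (k + (n * 2 + 2)) <=
    ((D + 1) * (1 + kappa + 2 * C) + 6 * C) * (work / eps).
Proof.
move=> C1 kappa0 D0 eps0 eps1 n1 hn w0 r0 hr hk.
have inv1 : 1 <= eps^-1 by rewrite invf_ge1.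
have kw : kappa * work + 2 <= (kappa + 2 * C) * work by rewrite mulrDl; lra.
have kw0 : 0 <= kappa * work + 2 by rewrite addr_ge0 // mulr_ge0.
have h : r * (kappa * work + 2) <= (D + 1) / eps * ((kappa + 2 * C) * work).
  exact: ler_pM.
have h6 : 6 * (C * work) <= 6 * (C * work) * eps^-1.
  by rewrite ler_peMr //; lra.
have h7 : 0 <= (D + 1) * work / eps.
  by rewrite divr_ge0 ?(ltW eps0) // mulr_ge0 // addr_ge0.
have -> : ((D + 1) * (1 + kappa + 2 * C) + 6 * C) * (work / eps) =
  (D + 1) / eps * ((kappa + 2 * C) * work) + 6 * (C * work) * eps^-1 +
    (D + 1) * work / eps by ring.
lra.
Qed.

Theorem theorem2 (R : realType) (omega beta Delta C0 : R)
    (homega : mm_exponent omega) (hbeta : 0 < beta < 1) :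
  exists K : R, forall m n : nat, (0 < m)%N -> (m <= n)%N ->
  exists P : program R,
  forall (A : 'M[R]_(m, n)) (b : 'cV[R]_m) (f : 'cV[R]_n -> R)
         (x0 xstar : 'cV[R]_n) (eps : R),
    row_free A ->
    {within @nonneg R n, continuous f} ->
    (forall x, @positive R n x -> differentiable f x) ->
    is_global_min A b f xstar ->
    concave_on (interior_feasible A b) f ->
    interior_feasible A b x0 ->
    (forall x, interior_feasible A b x -> barrier x0 - C0 <= barrier x) ->
    f x0 - f xstar <= Delta ->
    0 < eps <= 1 ->
    let T := iteration_limit f eps beta x0 xstar C0 in
    (forall (N : nat) (y : 'cV[R]_n), returns A f eps beta T 0 x0 N y ->
       N%:R <= K / eps /\
       (- beta - beta ^+ 2 <= ln (1 - beta) ->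
        kkt_point A b f (2 * eps) y \/ f y - f xstar <= eps)) /\
    (forall s : memory R, input_at s A b x0 eps beta T ->
     exists (s' : memory R) (k N : nat) (y : 'cV[R]_n),
       [/\ exec f P s s' k,
           returns A f eps beta T 0 x0 N y,
           mx_at s' 0 y /\ s' n = N%:R
         & k%:R <= K * (n%:R * m%:R `^ (omega - 1) / eps)]).
Proof.
have [C mm_program] := homega; have /andP[b0 b1] := hbeta.
have C1 := C_ge1 mm_program.
(* As [eps <= 1], the numerator of T is at most [|Delta| + |C0| + 1], so [D1 / eps] bounds T with D1
   independent of the instance. *)
pose D1 := (`|Delta| + `|C0| + 1) / (beta * (1 - beta)).
pose kappa := (168 + 135 * 2 `^ (omega - 1)) * C.
have D1_ge0 : 0 <= D1 by rewrite divr_ge0 ?addr_ge0 // ltW // mulr_gt0 // subr_gt0.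
have kappa_ge0 : 0 <= kappa.
  rewrite mulr_ge0 ?addr_ge0 ?mulr_ge0 ?powR_ge0 //; lra.
exists ((D1 + 1) * (1 + kappa + 2 * C) + 6 * C) => m n m_gt0 le_mn.
(* One constant for both bounds: [D1 + 1 <= K] handles the iteration count, and [6 * C] absorbs the
   [2 n + 4] operations outside the iterations. *)
set K := _ + 6 * C.
have [P HP] := iteration_code mm_program m_gt0 le_mn.
exists (Seq (Instr (Const (m * n + m + n).+3 0))
  (Seq (WhileLt (m * n + m + n).+3 (m * n + m + n).+2 P)
  (Seq (copy R 0 (m * n + m) n) (copy R n (m * n + m + n).+3 1)))).
move=> A b f x0 xstar eps Afree _ f_diff _ f_concave ix0 x0_center hDelta
  /andP[eps0 eps1] T.
have T_le : T <= D1 / eps.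
  have c0 : 0 < beta * (1 - beta) by rewrite mulr_gt0 // subr_gt0.
  have -> : D1 / eps = (`|Delta| + `|C0| + 1) / (eps * beta * (1 - beta)).
    by rewrite /D1; field; rewrite !gt_eqF // subr_gt0.
  rewrite ler_pM2r; last first.
    by rewrite invr_gt0 -mulrA mulr_gt0.
  have h1 := ler_norm Delta; have h2 := ler_norm C0.
  have : (C0 - 1) * eps <= `|C0| * 1.
    apply: (@le_trans _ _ (`|C0| * eps)); last by rewrite ler_wpM2l.
    by rewrite ler_pM2r //; lra.
  lra.
have T1_le : Num.max 0 (T + 1) <= (D1 + 1) / eps.
  have e1 : 1 <= eps^-1 by rewrite invf_ge1.
  rewrite ge_max divr_ge0 ?addr_ge0 ?(ltW eps0) //= mulrDl mul1r; lra.
split.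
  move=> N y ret; split.
    have := returns_count ret; rewrite le_max lexx => /(_ isT).
    move=> /le_trans/(_ T1_le)/le_trans; apply.
    rewrite ler_pM2r ?invr_gt0 // /K.
    have : 0 <= (D1 + 1) * (kappa + 2 * C) by rewrite mulr_ge0 ?addr_ge0 //; lra.
    have -> : (D1 + 1) * (1 + kappa + 2 * C) =
      D1 + 1 + (D1 + 1) * (kappa + 2 * C) by ring.
    lra.
  move=> ln_beta.
  apply: (returns_quality hbeta eps0 f_diff ln_beta f_concave Afree x0_center ret ix0).
  by rewrite subrr mul0r oppr0.
move=> s inp; pose s0 := store s (m * n + m + n).+3 0.
have [st0 sT0] : state_at s0 A x0 eps beta 0 /\ s0 (m * n + m + n).+2 = T :=
  input_state inp.
(* The truncation of T plus one is an integer limit at least T; for [T <= 0] the choice r = 0 keeps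
   the bound. *)
have [r Tr r_le] : exists2 r : nat, T <= r%:R & r%:R <= (D1 + 1) / eps.
  have [T0|T0] := leP T 0.
    by exists 0%N => //; apply: le_trans T1_le; rewrite le_max lexx.
  exists (Num.truncn T).+1; first exact/ltW/truncnS_gt.
  by apply: le_trans T1_le; rewrite le_max -natr1 lerD2r truncn_le (ltW T0) orbT.
have P_iteration s1 x N (px : positive x) (st : state_at s1 A x eps beta N) :=
  HP f s1 A x eps beta N hbeta Afree px f_diff st.
have [s1 [k [N [y [ex1 ret1 st1 k_le]]]]] :=
  exec_loop hbeta P_iteration (Tr : T <= (0 + r)%N%:R) ix0 st0 sT0.
pose s2 := run f (copy R 0 (m * n + m) n) s1.
pose s3 := run f (copy R n (m * n + m + n).+3 1) s2.
have out : mx_at s3 0 y /\ s3 n = N%:R := output_state f m_gt0 st1.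
have ex2 := exec_straight f s1 (straight_copy R 0 (m * n + m) n).
have ex3 : exec f (copy R n (m * n + m + n).+3 1) s2 s3 _ :=
  exec_straight f s2 (straight_copy R n (m * n + m + n).+3 1).
rewrite -/s2 in ex2; rewrite !cost_copy in ex2 ex3.
clearbody s3 s2.
exists s3, (1 + (k + (n * 2 + 1 * 2)))%N, N, y; split.
- have ex0 := ExecInstr f (Const (m * n + m + n).+3 0) s.
  exact: ExecSeq ex0 (ExecSeq ex1 (ExecSeq ex2 ex3)).
- exact: ret1.
- exact: out.
pose work : R := n%:R * m%:R `^ (omega - 1).
have work_le : n%:R <= C * work.
  apply: le_trans (mul_le_work mm_program n m_gt0).
  by rewrite ler_nat leq_pmulr.
rewrite -/work; rewrite /iteration_cost -/work -/kappa in k_le.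
rewrite /K !natrD natrM; apply: total_cost_le r_le k_le => //.
- by rewrite ler1n (leq_trans m_gt0).
- by rewrite mulr_ge0 ?powR_ge0.
Qed.
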